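(* The family of back stable standard elementary monomials $\{\overleftarrow{\mathbf e}_\alpha:\alpha\in\mathcal C\}$ and the family of back stable Schubert polynomials $\{\overleftarrow{\mathfrak S}_w:w\in S_{\mathbb Z}\}$ both form $\mathbb Q$-linear bases of the same ring $\mathcal R$.
   Context: Ring. $\Lambda^-=\Lambda(\ldots,x_{-1},x_0)$ is the ring of symmetric functions over $\mathbb Q$ in the variables $x_i$, $i\le 0$, and $\mathcal R=\Lambda^-\otimes_{\mathbb Q}\mathbb Q[x_i\mid i\in\mathbb Z]$, identified via multiplication with a ring of bounded-degree formal power series in the variables $x_i$, $i\in\mathbb Z$. For every $k\in\mathbb Z$ and $d\ge 0$ the elementary symmetric function $\mathbf e_d(\ldots,x_{k-1},x_k)$ in the variables $x_i$, $i\le k$, lies in $\mathcal R$ (with $\mathbf e_0=1$). Back stable SEMs. $\mathcal C$ is the set of finitely supported tuples $\alpha=(\alpha_i)_{i\in\mathbb Z}$ of nonnegative integers. For $\alpha\in\mathcal C$, $\overleftarrow{\mathbf e}_\alpha=\prod_{i\in\mathbb Z}\mathbf e_{\alpha_i}(\ldots,x_{i-1},x_i)\in\mathcal R$. Permutations. $S_{\mathbb Z}$ is the group of permutations of $\mathbb Z$ moving only finitely many integers; $S_\infty\subset S_{\mathbb Z}$ is the subgroup of those fixing every $i\le 0$; $s_i$ is the transposition $(i,i+1)$; $\ell$ is Coxeter length. The shift $\gamma$ acts by $\gamma(s_i)=s_{i+1}$, i.e. $\gamma(w)(i)=w(i-1)+1$, and on variables by $\gamma(x_i)=x_{i+1}$.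 Schubert polynomials. For $w\in S_\infty$, $\mathfrak S_w\in\mathbb Q[x_1,x_2,\ldots]$ is the usual Schubert polynomial: for the longest element $w_0\in S_n$, $\mathfrak S_{w_0}=x_1^{n-1}x_2^{n-2}\cdots x_{n-1}$, and $\partial_i\mathfrak S_w=\mathfrak S_{ws_i}$ whenever $\ell(ws_i)<\ell(w)$, where $\partial_i f=(f-s_if)/(x_i-x_{i+1})$. For $w\in S_{\mathbb Z}$ the back stable Schubert polynomial is the coefficientwise limit $\overleftarrow{\mathfrak S}_w=\lim_{m\to\infty}\gamma^{-m}\big(\mathfrak S_{\gamma^m(w)}\big)$ (taken over $m$ large enough that $\gamma^m(w)\in S_\infty$); it lies in $\mathcal R$. *)

(* Defs.v *)
From HB Require Import structures.
From mathcomp Require Import all_boot all_order all_algebra.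
From mathcomp Require Import finmap.
From mathcomp Require Import mathcomp_extra boolp classical_sets functions.
From mathcomp Require Import cardinality fsbigop.
From mathcomp Require Import monalg.

Set Implicit Arguments.
Unset Strict Implicit.
Unset Printing Implicit Defensive.

Import Order.TTheory GRing.Theory Num.Theory.

Local Open Scope classical_set_scope.
Local Open Scope ring_scope.

Local Notation monom := {cmonom int}.

Local Notation polyZ := {malg rat[{cmonom int}]}.

Definition var (i : int) : polyZ := << ucm i >>.

(* The substitution x_j |-> x_(f j), on monomials and on polynomials. *)
Definition mrename (f : int -> int) (m : monom) : monom :=
  \big[mmul/mone]_(i <- finsupp m) expcmn (ucm (f i)) (m i).

Definition prename (f : int -> int) (p : polyZ) : polyZ :=
  \sum_(m <- msupp p) << p@_m *g mrename f m >>.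

(* Formal power series over Q in the variables x_i, i in Z; the type fps is kept
   distinct from monom -> rat, which carries the pointwise product. *)
Definition fps := monom -> rat.
HB.instance Definition _ := Choice.on fps.
HB.instance Definition _ := GRing.Zmodule.copy fps (monom -> rat).
HB.instance Definition _ := GRing.Lmodule.copy fps (monom -> rat^o).

Definition fps_of_poly (p : polyZ) : fps := fun m => p@_m.

Definition fps_one : fps := fun m => (m == mone)%:R.

Definition fps_mul (f g : fps) : fps := fun m =>
  \sum_(ab \in [set ab : monom * monom | mmul ab.1 ab.2 = m]) f ab.1 * g ab.2.

Lemma finite_factor (m : monom) :
  finite_set [set ab : monom * monom | mmul ab.1 ab.2 = m].
Proof.
pose A := [set a : monom | forall i, (a i <= m i)%N].
suff fA : finite_set A.
  apply: (sub_finite_set _ (finite_setX fA fA)) => -[a b] /= abm.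
  by split=> i /=; rewrite -abm cmM ?leq_addr ?leq_addl.
pose T := {ffun finsupp m -> 'I_(mdeg m).+1}.
pose g (t : T) : monom := [cmonom nat_of_ord (t i) | i : finsupp m]%M.
apply: (@sub_finite_set _ _ (g @` [set: T])); last exact/finite_image/finite_finset.
move=> a aA; have le_deg i : (a i < (mdeg m).+1)%N.
  rewrite ltnS (leq_trans (aA i)) //.
  have [|im] := boolP (i \in finsupp m); last by move: im; rewrite -cmE_eq0 => /eqP ->.
  by move=> im; rewrite mdegE (big_fsetD1 i) //= leq_addr.
exists [ffun i : finsupp m => Ordinal (le_deg (val i))] => //.
apply/eqP/cmP => i; rewrite /g cmE /= fsfun_ffun; case: insubP => [u _ uE|im] /=.
  by rewrite ffunE /= uE.
by have := aA i; move: im; rewrite -cmE_eq0 => /eqP ->; rewrite leqn0 => /eqP.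
Qed.

Lemma fps_mulE (f g : fps) m :
  fps_mul f g m =
  \sum_(ab <- fset_set [set ab : monom * monom | mmul ab.1 ab.2 = m])
     f ab.1 * g ab.2.
Proof. exact/fsbig_finite/finite_factor. Qed.

Lemma fps_of_polyM (p q : polyZ) :
  fps_mul (fps_of_poly p) (fps_of_poly q) = fps_of_poly (p * q).
Proof.
apply/funext => m; rewrite fps_mulE /fps_of_poly.
have -> : (p * q)@_m =
    \sum_(ab <- [seq (a, b) | a <- msupp p, b <- msupp q] |
      mmul ab.1 ab.2 == m) p@_ab.1 * q@_ab.2.
  rewrite malgME raddf_sum [RHS]big_mkcond big_allpairs /=.
  apply: eq_bigr => a _; rewrite raddf_sum; apply: eq_bigr => b _ /=.
  by rewrite mcoeffU; case: eqP.
rewrite (bigID (fun ab : monom * monom =>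
  (ab.1 \in msupp p) && (ab.2 \in msupp q))) /= [X in _ + X]big1 ?addr0.
  rewrite -big_filter -[RHS]big_filter; apply: perm_big; apply: uniq_perm.
  - exact/filter_uniq/fset_uniq.
  - by apply/filter_uniq/allpairs_uniq; rewrite ?fset_uniq// => -[? ?] [? ?].
  move=> [a b]; rewrite !mem_filter /= in_fset_set; last exact: finite_factor.
  rewrite andbC; congr (_ && _).
    by apply/idP/eqP; rewrite inE.
  by apply/andP/allpairsP => [[? ?]|[[a' b'] [/= ? ? [-> ->]]]//]; exists (a, b).
move=> [a b] /=; rewrite negb_and.
by case/orP => /mcoeff_outdom ->; rewrite (mul0r, mulr0).
Qed.

Lemma fps_mul_local (m : monom) (f f' g g' : fps) :
  (forall a b, mmul a b = m -> f a = f' a /\ g b = g' b) ->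
  fps_mul f g m = fps_mul f' g' m.
Proof.
move=> eqm; rewrite !fps_mulE; apply: eq_big_seq => -[a b].
rewrite in_fset_set; last exact: finite_factor.
by rewrite inE /= => /eqm [-> ->].
Qed.

Lemma fps_approx (m : monom) (f : fps) :
  exists p : polyZ, forall a b, mmul a b = m -> f a = p@_a.
Proof.
pose A : {fset monom} :=
  [fset ab.1 | ab in fset_set [set ab : monom * monom | mmul ab.1 ab.2 = m]]%fset.
exists [malg a in A => f a] => a b abm; rewrite mcoeffE ifT//.
apply/imfsetP; exists (a, b) => //=.
by rewrite in_fset_set ?inE//=; exact: finite_factor.
Qed.

Lemma fps_mulC : commutative fps_mul.
Proof.
move=> f g; apply/funext => m.
have [p pE] := fps_approx m f; have [q qE] := fps_approx m g.
transitivity (fps_mul (fps_of_poly p) (fps_of_poly q) m).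
  by apply: fps_mul_local => a b abm; split; [exact: pE abm|apply: (qE _ a); rewrite mulmC].
rewrite !fps_of_polyM mulrC -fps_of_polyM.
apply: fps_mul_local => a b abm; split; first exact/esym/(qE _ b).
by apply/esym/(pE _ a); rewrite mulmC.
Qed.

Lemma fps_mulA : associative fps_mul.
Proof.
move=> f g h; apply/funext => m.
have [p pE] := fps_approx m f; have [q qE] := fps_approx m g.
have [r rE] := fps_approx m h.
transitivity (fps_of_poly (p * (q * r)) m).
  rewrite -!fps_of_polyM; apply: fps_mul_local => a b abm.
  split; first exact: pE abm.
  apply: fps_mul_local => c d cdb; split.
    by apply: (qE _ (mmul a d)); rewrite -abm -cdb mulmA (mulmC c a) mulmA.
  by apply: (rE _ (mmul a c)); rewrite -abm -cdb (mulmC d) mulmA.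
rewrite mulrA -!fps_of_polyM; apply: fps_mul_local => b d bdm.
split; last by apply/esym/(rE _ b); rewrite mulmC.
apply: fps_mul_local => a c acb; split; apply: esym.
  by apply: (pE _ (mmul c d)); rewrite -bdm -acb mulmA.
by apply: (qE _ (mmul a d)); rewrite -bdm -acb mulmA (mulmC c a).
Qed.

Lemma fps_mul1 : left_id fps_one fps_mul.
Proof.
move=> f; apply/funext => m; have [p pE] := fps_approx m f.
have -> : fps_one = fps_of_poly 1.
  by apply/funext => a; rewrite /fps_of_poly mcoeff1.
transitivity (fps_of_poly (1 * p) m).
  rewrite -fps_of_polyM; apply: fps_mul_local => a b abm; split=> //.
  by apply: (pE _ a); rewrite mulmC.
by rewrite mul1r /fps_of_poly -(pE m mone)// mulm1.
Qed.

Lemma fps_mulDl : left_distributive fps_mul +%R.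
Proof.
move=> f g h; apply/funext => m.
transitivity (fps_mul f h m + fps_mul g h m) => //.
rewrite !fps_mulE -big_split.
by apply: eq_bigr => ab _; rewrite /= -mulrDl.
Qed.

Lemma fps_one_neq0 : fps_one != 0.
Proof.
apply/eqP => /(congr1 (fun f : fps => f mone)).
by rewrite /fps_one eqxx => /eqP; rewrite oner_eq0.
Qed.

HB.instance Definition _ := GRing.Zmodule_isComNzRing.Build fps
  fps_mulA fps_mulC fps_mul1 fps_mulDl fps_one_neq0.

Lemma fps_scalerAl (c : rat) (f g : fps) : c *: (f * g) = (c *: f) * g.
Proof.
apply/funext => m; transitivity (c * fps_mul f g m) => //.
transitivity (fps_mul (c *: f) g m) => //.
rewrite !fps_mulE big_distrr.
by apply: eq_bigr => ab _ /=; rewrite mulrA.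
Qed.

HB.instance Definition _ := GRing.Lmodule_isLalgebra.Build rat fps fps_scalerAl.
HB.instance Definition _ := GRing.Lalgebra_isComAlgebra.Build rat fps.

(* The group S_Z; the product is composition, (u * v) i = u (v i). *)
Record permZ := PermZ {
  permZ_fun :> int -> int;
  permZ_bij : bijective permZ_fun;
  permZ_fin : finite_set [set i | permZ_fun i <> i] }.

HB.instance Definition _ := gen_eqMixin permZ.
HB.instance Definition _ := gen_choiceMixin permZ.

Lemma permZ_ext (u v : permZ) : u =1 v -> u = v.
Proof.
case: u v => [u ubij ufin] [v vbij vfin] /= /funext uv.
by move: ubij ufin; rewrite uv => ubij ufin; congr PermZ; exact: Prop_irrelevance.
Qed.

Definition permZ_one : permZ.
Proof.
refine (@PermZ id (Bijective (frefl _) (frefl _)) _).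
by apply: (sub_finite_set _ (finite_set0 int)) => i /=.
Defined.

Definition permZ_mul (u v : permZ) : permZ.
Proof.
refine (@PermZ (u \o v) (bij_comp (permZ_bij u) (permZ_bij v)) _).
have := conj (permZ_fin u) (permZ_fin v); rewrite -finite_setU.
apply: sub_finite_set => i /= uvi.
by have [vi|] := pselect (v i = i); [left; rewrite vi in uvi | right].
Defined.

Lemma permZ_inv_subproof (u : permZ) :
  exists v : permZ, cancel u v /\ cancel v u.
Proof.
have [g ug gu] := permZ_bij u.
have gfin : finite_set [set i | g i <> i].
  apply: (sub_finite_set _ (permZ_fin u)) => i /= gi ui.
  by apply: gi; rewrite -[in LHS]ui ug.
by exists (PermZ (Bijective gu ug) gfin).
Qed.

Definition permZ_inv (u : permZ) : permZ := projT1 (cid (permZ_inv_subproof u)).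

Lemma permZ_mulA : associative permZ_mul.
Proof. by move=> u v w; exact: permZ_ext. Qed.

Lemma permZ_mul1 : left_id permZ_one permZ_mul.
Proof. by move=> u; exact: permZ_ext. Qed.

Lemma permZ_mulr1 : right_id permZ_one permZ_mul.
Proof. by move=> u; exact: permZ_ext. Qed.

Lemma permZ_mulV : left_inverse permZ_one permZ_inv permZ_mul.
Proof.
by move=> u; apply: permZ_ext; rewrite /permZ_inv /=; case: cid => v [].
Qed.

Lemma permZ_mulrV : right_inverse permZ_one permZ_inv permZ_mul.
Proof.
by move=> u; apply: permZ_ext; rewrite /permZ_inv /=; case: cid => v [].
Qed.

HB.instance Definition _ := isGroup.Build permZ
  permZ_mulA permZ_mul1 permZ_mulr1 permZ_mulV permZ_mulrV.

Lemma adj_swapK (i : int) :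
  involutive [eta id with i |-> i + 1, i + 1 |-> i].
Proof.
have ne : (i + 1 == i) = false by apply/negbTE; rewrite -subr_eq0 addrAC subrr.
move=> j /=; have [->|ji] := eqVneq j i; first by rewrite ne eqxx.
by have [->|ji1] := eqVneq j (i + 1); rewrite ?eqxx // (negbTE ji) (negbTE ji1).
Qed.

Definition sZ (i : int) : permZ.
Proof.
refine (PermZ (inv_bij (@adj_swapK i)) _).
apply: (sub_finite_set _ (finite_set2 i (i + 1))) => j /=.
have [->|ji] := eqVneq j i; first by left.
by have [->|ji1] := eqVneq j (i + 1); first by right.
Defined.

Definition gammaZ (w : permZ) : permZ.
Proof.
refine (@PermZ (fun i => w (i - 1) + 1) _ _).
  have [g wg gw] := permZ_bij w.
  by exists (fun i => g (i - 1) + 1) => i; rewrite addrK ?wg ?gw subrK.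
apply: (sub_finite_set _ (finite_image (fun i => i + 1) (permZ_fin w))) => i wi.
exists (i - 1); last by rewrite subrK.
by move=> /= wi1; apply: wi; rewrite wi1 subrK.
Defined.

(* The lengths of the words in the simple transpositions that represent w; the
   Coxeter length is the least of them. *)
Definition word_length (w : permZ) : set nat :=
  [set n | exists s : n.-tuple int, w = (\prod_(i <- s) sZ i)%g].

Definition coxlen (w : permZ) : nat :=
  xget 0%N [set n | word_length w n /\
                    forall k, word_length w k -> (n <= k)%N].

Definition S_infty : set permZ := [set w : permZ | forall i : int, i <= 0 -> w i = i].

Definition S_fin (n : nat) : set permZ :=
  [set w : permZ | forall i : int, ~~ (1 <= i <= n%:Z) -> w i = i].

Definition longest (n : nat) (w : permZ) : Prop :=
  S_fin n w /\ forall v, S_fin n v -> (coxlen v <= coxlen w)%N.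

(* The quotient (f - s_i f) / (x_i - x_(i + 1)), which is unique because the
   polynomial ring is an integral domain. *)
Definition divdiff (i : int) (f : polyZ) : polyZ :=
  xget 0 [set g : polyZ | (var i - var (i + 1)) * g = f - prename (sZ i) f].

(* These conditions determine S on S_infty, and leave it free elsewhere. *)
Definition schubert_family (S : permZ -> polyZ) : Prop :=
  (forall n w0, longest n w0 ->
     S w0 = \prod_(1 <= i < n) var i%:Z ^+ (n - i)) /\
  (forall (w : permZ) (i : int), S_infty w -> 1 <= i -> (coxlen (w * sZ i)%g < coxlen w)%N ->
     divdiff i (S w) = S (w * sZ i)%g).

Definition schubert : permZ -> polyZ := xget (fun=> 0) schubert_family.

(* Coefficientwise limit: the eventual value of each coefficient of
   gamma^(-k) S_(gamma^k w). In the limit only the k with gamma^k w in S_infty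
   matter. *)
Definition back_stable_schubert (w : permZ) : fps := fun m =>
  xget 0 [set c : rat | exists N : nat, forall k : nat, (N <= k)%N ->
    (prename (fun i => i - k%:Z) (schubert (iter k gammaZ w)))@_m = c].

(* e_d(..., x_(k-1), x_k): the sum of the squarefree monomials of degree d in
   the variables x_i, i <= k. *)
Definition elemsym (k : int) (d : nat) : fps := fun m =>
  ((mdeg m == d) && all (fun i => (i <= k) && (m i == 1%N)) (finsupp m))%:R.

(* The factors outside the support of alpha are e_0 = 1. *)
Definition back_stable_sem (alpha : {fsfun int -> nat with 0%N}) : fps :=
  \prod_(i <- finsupp alpha) elemsym i (alpha i).

(* Bounded degree, only the variables x_i with i <= 0, and invariance under the
   finitary permutations of these variables. *)
Definition Lambda_minus : set fps := [set f : fps |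
  [/\ exists d : nat, forall m : monom, f m != 0 -> (mdeg m <= d)%N,
      forall m : monom, f m != 0 -> forall i : int, i \in finsupp m -> i <= 0
    & forall w : permZ, (forall i : int, 0 < i -> w i = i) ->
        forall m : monom, f (mrename w m) = f m]].

(* The image of Lambda^- (x) Q[x_i | i in Z] under multiplication: finite sums of
   products of an element of Lambda^- and a polynomial. *)
Definition ringR : set fps := [set F : fps |
  exists (n : nat) (f : 'I_n -> fps) (p : 'I_n -> polyZ),
    (forall j, Lambda_minus (f j)) /\
    F = \sum_(j < n) f j * fps_of_poly (p j)].

Section Basis.
Variables (V : lmodType rat) (T : eqType) (b : T -> V).

Definition lin_span : set V :=
  [set v | exists (s : seq T) (c : T -> rat), v = \sum_(i <- s) c i *: b i].

Definition lin_indep : Prop :=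
  forall (s : seq T) (c : T -> rat), uniq s ->
    \sum_(i <- s) c i *: b i = 0 -> {in s, forall i, c i = 0}.

Definition is_basis (U : set V) : Prop := lin_indep /\ lin_span = U.

End Basis.

(* Main.v *)
(* Divided differences d_i = (1 - s_i) / (x_i - x_(i + 1)) act on all power series, and
   satisfy the nil-Coxeter relations, so d_w makes sense for every permutation w of the
   integers. Call a series back stable if it has bounded degree, involves only variables
   x_i with i <= b, and is symmetric in the x_i with i <= a, for some a and b.

   Schubert polynomials: d_i maps the back stable Schubert polynomial of w to that of
   w s_i if i is a descent of w, and to 0 otherwise. Hence "constant term of d_w F" is the
   coordinate of F at w. A back stable F has finitely many nonzero coordinates, and F = 0 if
   they all vanish: by induction on the degree all d_i F vanish, so F is symmetric in all
   the variables, although it involves none of the large ones. The limit defining these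
   series is reached because the terms of S_(gamma^k w) and S_(gamma^(k + 1) w) without
   small variables satisfy the same recursion under the d_i.

   Elementary monomials: they are independent because the constant terms of the
   d_(k_m - b_m + 1) ... d_(k_m) ... d_(k_1 - b_1 + 1) ... d_(k_1), for k_1 < ... < k_m, pair
   with them unitriangularly. Their span is closed under multiplication by every e_i(k),
   because e_i(k) e_j(k) is a combination of the products e_a(k) e_c(k + 1); so it contains
   the polynomials, and the symmetric functions by their fundamental theorem. Therefore it
   is equal to R, and to the ring of back stable series. *)

From HB Require Import structures.
From mathcomp Require Import all_boot all_order all_algebra.
From mathcomp Require Import fingroup perm.
From mathcomp Require mpoly.
Require Import Defs.
From mathcomp Require Import finmap.
From mathcomp Require Import boolp classical_sets functions cardinality fsbigop monalg.
From mathcomp Require Import ring lra zify.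

Set Implicit Arguments.
Unset Strict Implicit.
Unset Printing Implicit Defensive.

Import Order.TTheory GRing.Theory Num.Theory.

Local Open Scope classical_set_scope.
Local Open Scope ring_scope.

Local Notation monom := {cmonom int}.
Local Notation polyZ := {malg rat[{cmonom int}]}.

(** Divided differences are taken on all power series, so that one operator serves polynomials,
    symmetric functions and limits; identities are checked after multiplication by x_i - x_(i + 1),
    which is not a zero divisor. The description of R by sums of products does not fit these
    operators, whereas bounds a, b and a degree do: d_i lowers the degree, changes a and b in a
    controlled way, and is zero unless a <= i <= b. This is the source of the finiteness of the
    coordinates and of the inductions on the degree. The length, the quotient, the Schubert
    polynomials and the limit are all choices of a value with some property, so each must first be
    shown to exist. For the Schubert polynomials this means that neither the reduced word nor the
    ambient group S_n matters. A back stable series reaches the span of the elementary monomials by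
    splitting off x_b until it is symmetric in all the variables that it involves; such a series of
    degree at most d is determined by its terms in d variables, where the fundamental theorem for
    polynomials applies. *)

(** * Monomials and renaming of variables *)

Lemma monomP (a b : monom) : a =1 b -> a = b.
Proof. by move=> ab; apply/eqP/cmP. Qed.

Lemma expcmnE (I : choiceType) (m : {cmonom I}) n j : expcmn m n j = (n * m j)%N.
Proof.
rewrite /expcmn; case: n => [|n]; first exact: onecmE.
rewrite iteropS; elim: n => [|n IHn] /=; first by rewrite mul1n.
by rewrite mulcmE IHn -mulSn.
Qed.

Lemma cm_prodE (I : choiceType) (T : Type) (s : seq T) (P : pred T) (F : T -> {cmonom I}) j :
  (\big[mmul/mone]_(i <- s | P i) F i) j = (\sum_(i <- s | P i) F i j)%N.
Proof.
by apply: (big_morph (fun m : {cmonom I} => m j)) => [a b|]; rewrite ?cmM ?cm1.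
Qed.

Lemma mrenameE (f g : int -> int) (m : monom) j :
  cancel f g -> cancel g f -> mrename f m j = m (g j).
Proof.
move=> fK gK; rewrite cm_prodE.
under eq_bigr => i _ do rewrite expcmnE cmU.
have fE i : (f i == j) = (i == g j) by rewrite -[in LHS](gK j) (can_eq fK).
under eq_bigr => i _ do rewrite fE mulnbr.
have [gj|gj] := boolP (g j \in finsupp m).
  rewrite (big_fsetD1 (g j)) //= eqxx big1_seq ?addn0 // => i /=.
  by rewrite !inE => /andP[/negPf->].
rewrite big1_seq => [|i /= im]; last by case: eqP im gj => // -> ->.
by move: gj; rewrite -cmE_eq0 => /eqP.
Qed.

Lemma mrenameK (f g : int -> int) : cancel f g -> cancel g f ->
  cancel (mrename f) (mrename g).
Proof.
by move=> fK gK m; apply: monomP => j; rewrite (mrenameE _ _ gK fK) (mrenameE _ _ fK gK) fK.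
Qed.

Lemma mrenameM (f g : int -> int) (a b : monom) : cancel f g -> cancel g f ->
  mrename f (mmul a b) = mmul (mrename f a) (mrename f b).
Proof.
by move=> fK gK; apply: monomP => j; rewrite cmM !(mrenameE _ _ fK gK) cmM.
Qed.

Lemma mrename_comp (f1 g1 f2 g2 : int -> int) (m : monom) :
  cancel f1 g1 -> cancel g1 f1 -> cancel f2 g2 -> cancel g2 f2 ->
  mrename f1 (mrename f2 m) = mrename (f1 \o f2) m.
Proof.
move=> ? ? ? ?; apply: monomP => j; rewrite (@mrenameE (f1 \o f2) (g2 \o g1)) /=.
- by rewrite (@mrenameE f1 g1) // (@mrenameE f2 g2).
- exact: can_comp.
- exact: can_comp.
Qed.

Lemma mrename_ext (f g : int -> int) : f =1 g -> mrename f =1 mrename g.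
Proof. by move=> /funext ->. Qed.

Lemma mdeg_expU (I : choiceType) (i : I) n : mdeg (expcmn (ucm i) n) = n.
Proof.
rewrite /expcmn; case: n => [|n]; first exact: mdeg1.
rewrite iteropS; elim: n => [|n IHn] /=; first by rewrite mdegU.
by rewrite mdegM IHn mdegU.
Qed.

Lemma mdeg_mrename (f : int -> int) (m : monom) : mdeg (mrename f m) = mdeg m.
Proof.
rewrite mdeg_prod [RHS]mdegE; apply: eq_bigr => i _.
exact: mdeg_expU.
Qed.

(** * Coefficients of formal power series *)

Lemma fpsP (F G : fps) : (forall m, F m = G m) <-> F = G.
Proof. by split=> [FG|-> //]; apply/funext. Qed.

Lemma fpsDE (F G : fps) m : (F + G) m = F m + G m. Proof. by []. Qed.
Lemma fpsNE (F : fps) m : (- F) m = - F m. Proof. by []. Qed.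
Lemma fpsBE (F G : fps) m : (F - G) m = F m - G m. Proof. by []. Qed.
Lemma fpsZE c (F : fps) m : (c *: F) m = c * F m. Proof. by []. Qed.
Lemma fps1E m : (1 : fps) m = (m == mone)%:R. Proof. by []. Qed.

Lemma fps_sumE (T : Type) (s : seq T) (P : pred T) (F : T -> fps) m :
  (\sum_(i <- s | P i) F i) m = \sum_(i <- s | P i) F i m.
Proof. by apply: (big_morph (fun F : fps => F m)). Qed.

Lemma fps_mulE' (F G : fps) m : (F * G) m =
  \sum_(ab <- fset_set [set ab : monom * monom | mmul ab.1 ab.2 = m]) F ab.1 * G ab.2.
Proof. exact: fps_mulE. Qed.

Lemma in_factor (m a b : monom) :
  ((a, b) \in fset_set [set ab : monom * monom | mmul ab.1 ab.2 = m]) = (mmul a b == m).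
Proof.
rewrite in_fset_set; last exact: finite_factor.
by apply/idP/eqP; rewrite inE.
Qed.

Lemma fps_mul_neq0 (F G : fps) m : (F * G) m != 0 ->
  exists a b, [/\ mmul a b = m, F a != 0 & G b != 0].
Proof.
rewrite fps_mulE'; apply: contraNP => H; apply/eqP; rewrite big1_seq // => -[a b] /=.
rewrite in_factor => /eqP abm; apply/eqP; rewrite mulf_eq0.
apply: contrapT => /negP; rewrite negb_or => /andP[Fa Gb].
by apply: H; exists a, b.
Qed.

Lemma fps_of_poly_additive : additive fps_of_poly.
Proof. by move=> p q; apply/fpsP => m; rewrite /fps_of_poly mcoeffB. Qed.

HB.instance Definition _ :=
  GRing.isAdditive.Build polyZ fps fps_of_poly fps_of_poly_additive.

Lemma fps_of_poly_monoid : monoid_morphism fps_of_poly.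
Proof.
split; first by apply/fpsP => m; rewrite /fps_of_poly mcoeff1.
by move=> p q; rewrite -fps_of_polyM.
Qed.

HB.instance Definition _ :=
  GRing.isMonoidMorphism.Build polyZ fps fps_of_poly fps_of_poly_monoid.

Lemma fps_of_polyZ c (p : polyZ) : fps_of_poly (c *: p) = c *: fps_of_poly p.
Proof. by apply/fpsP => m; rewrite /fps_of_poly mcoeffZ. Qed.

Lemma fps_of_poly_inj : injective fps_of_poly.
Proof. by move=> p q /fpsP pq; apply/malgP => m; exact: pq. Qed.

(* Locked, as are [sw] and [dd] below: unification would otherwise compare [X i] with [X j]
   by unfolding them to normal form. *)
HB.lock Definition X (i : int) : fps := fps_of_poly (var i).

Lemma X_polyE i : X i = fps_of_poly (var i). Proof. by rewrite X.unlock. Qed.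

Lemma fps_of_polyUE a (m : monom) : fps_of_poly << a >> m = (a == m)%:R.
Proof. by rewrite /fps_of_poly mcoeffU1. Qed.

Lemma fps_monomM (a : monom) (F : fps) m :
  (fps_of_poly << a >> * F) m = if [forall i : finsupp a, (a (val i) <= m (val i))%N]
    then F (divcm m a) else 0.
Proof.
rewrite fps_mulE'; case: ifPn => [/forallP am|nam].
  have aE : mmul a (divcm m a) = m.
    apply: monomP => j; rewrite cmM divcmE.
    have [ja|] := boolP (j \in finsupp a); first exact: (subnKC (am (Sub j ja))).
    by rewrite -cmE_eq0 => /eqP ->; rewrite add0n subn0.
  rewrite (big_fsetD1 (a, divcm m a)) ?in_factor ?aE //=.
  rewrite fps_of_polyUE eqxx mul1r big1_seq ?addr0 // => -[b c] /=.
  rewrite !inE in_factor xpair_eqE => /andP[bc /eqP bcm].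
  rewrite fps_of_polyUE; case: (eqVneq a b) => [ab|_]; last by rewrite mul0r.
  move: bc bcm; rewrite -ab eqxx /= => /eqP cE acm.
  case: cE; apply: monomP => j; rewrite divcmE -acm cmM addKn //.
rewrite big1_seq // => -[b c] /=; rewrite in_factor => /eqP bcm.
rewrite fps_of_polyUE; case: (eqVneq a b) => [ab|_]; last by rewrite mul0r.
case/negP: nam; apply/forallP => i; rewrite -bcm -ab cmM; exact: leq_addr.
Qed.

Lemma X_mulE i (F : fps) m :
  (X i * F) m = if m i == 0%N then 0 else F (divcm m (ucm i)).
Proof.
rewrite X_polyE /var fps_monomM -[RHS]if_neg; congr (if _ then _ else _).
have ii : i \in finsupp (ucm i) by rewrite mdomU inE.
apply/forallP/idP => [/(_ (Sub i ii))|mi [j /= jP]]; first by rewrite /= cmUU -lt0n.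
by move: jP; rewrite mdomU inE => /eqP ->; rewrite cmUU lt0n.
Qed.

Ltac case_ifs := repeat match goal with |- context [?a == ?b] =>
  lazymatch a with context [if _ then _ else _] => fail | _ => case: (eqVneq a b) => ? end end.

(** * Renaming and swapping variables in power series *)

(** Precomposition on monomials, so the inverse of [g] is substituted into the variables: [renX]
    sends [X i] to [X (h i)]. *)
Definition ren (g : int -> int) (F : fps) : fps := fun m => F (mrename g m).

Lemma renB g (F G : fps) : ren g (F - G) = ren g F - ren g G. Proof. by []. Qed.
Lemma renZ g c (F : fps) : ren g (c *: F) = c *: ren g F. Proof. by []. Qed.

Lemma renM (g h : int -> int) (F G : fps) : cancel g h -> cancel h g ->
  ren g (F * G) = ren g F * ren g G.
Proof.
move=> gK hK; apply/fpsP => m; rewrite /ren !fps_mulE'.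
pose r (ab : monom * monom) := (mrename h ab.1, mrename h ab.2).
rewrite (perm_big [seq (mrename g ab.1, mrename g ab.2) | ab <-
  fset_set [set ab : monom * monom | mmul ab.1 ab.2 = m]]) ?big_map //.
have gI : injective (mrename g) := can_inj (mrenameK gK hK).
apply: uniq_perm; first exact: fset_uniq.
  rewrite map_inj_uniq ?fset_uniq // => -[a b] [c d] [/gI -> /gI ->] //.
move=> [a b]; rewrite in_factor; apply/eqP/mapP => [abm|[[c d] + [-> ->]]].
  exists (mrename h a, mrename h b).
    by rewrite in_factor -(mrenameM _ _ hK gK) abm (mrenameK gK hK).
  by rewrite !(mrenameK hK gK).
by rewrite in_factor => /eqP <-; rewrite (mrenameM _ _ gK hK).
Qed.

Lemma mrename1 (f g : int -> int) : cancel f g -> cancel g f -> mrename f mone = mone.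
Proof. by move=> fK gK; apply: monomP => j; rewrite (mrenameE _ _ fK gK) !cm1. Qed.

Lemma mrenameU (f g : int -> int) i : cancel f g -> cancel g f ->
  mrename f (ucm i) = ucm (f i).
Proof.
move=> fK gK; apply: monomP => j; rewrite (mrenameE _ _ fK gK) !cmU.
by rewrite -[in RHS](gK j) (can_eq fK).
Qed.

Lemma XE i m : X i m = (ucm i == m)%:R.
Proof. rewrite X_polyE; exact: fps_of_polyUE. Qed.

Lemma renX (g h : int -> int) i : cancel g h -> cancel h g -> ren g (X i) = X (h i).
Proof.
move=> gK hK; apply/fpsP => m; rewrite /ren !XE.
suff -> : (ucm i == mrename g m) = (ucm (h i) == m) by [].
apply/eqP/eqP => [E|<-].
  by rewrite -(mrenameU i hK gK) E (mrenameK gK hK).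
by rewrite (mrenameU _ gK hK) hK.
Qed.

Lemma ren1 (g h : int -> int) : cancel g h -> cancel h g -> ren g 1 = 1.
Proof.
move=> gK hK; apply/fpsP => m; rewrite /ren !fps1E.
suff -> : (mrename g m == mone) = (m == mone) by [].
apply/eqP/eqP => [E|->]; last exact: mrename1 gK hK.
by rewrite -[m](mrenameK gK hK) E (mrename1 hK gK).
Qed.

Arguments permZ_fun : simpl never.

Lemma sZE i j : sZ i j = if j == i then i + 1 else if j == i + 1 then i else j.
Proof. by []. Qed.

Lemma sZK i : involutive (sZ i). Proof. exact: adj_swapK. Qed.

HB.lock Definition msw (i : int) (m : monom) : monom := mrename (sZ i) m.

Lemma mswE i (m : monom) j : msw i m j = m (sZ i j).
Proof. rewrite msw.unlock; exact: mrenameE (sZK i) (sZK i). Qed.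

Lemma mswK i : involutive (msw i).
Proof. rewrite msw.unlock; exact: (mrenameK (sZK i) (sZK i)). Qed.

Lemma mdeg_msw i (m : monom) : mdeg (msw i m) = mdeg m.
Proof. by rewrite msw.unlock mdeg_mrename. Qed.

HB.lock Definition sw (i : int) : fps -> fps := ren (sZ i).

Lemma swE i (F : fps) m : sw i F m = F (msw i m).
Proof. by rewrite sw.unlock msw.unlock. Qed.

Lemma swM i (F G : fps) : sw i (F * G) = sw i F * sw i G.
Proof. rewrite sw.unlock; exact: (renM _ _ (sZK i) (sZK i)). Qed.

Lemma swD i (F G : fps) : sw i (F + G) = sw i F + sw i G. Proof. by rewrite sw.unlock. Qed.
Lemma swB i (F G : fps) : sw i (F - G) = sw i F - sw i G. Proof. by rewrite sw.unlock. Qed.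

Lemma swX i j : sw i (X j) = X (sZ i j).
Proof. rewrite sw.unlock; exact: (renX _ (sZK i) (sZK i)). Qed.

Lemma sw1 i : sw i 1 = 1. Proof. rewrite sw.unlock; exact: (ren1 (sZK i) (sZK i)). Qed.

Lemma swK i : involutive (sw i).
Proof. by move=> F; apply/fpsP => m; rewrite !swE mswK. Qed.

Lemma sw_comm (i j : int) F : (i + 1 < j) -> sw i (sw j F) = sw j (sw i F).
Proof.
move=> ij; apply/fpsP => m; rewrite !swE; apply: (congr1 F); apply: monomP => k.
rewrite !mswE !sZE; apply: (congr1 m).
case_ifs; lia.
Qed.

Lemma sZ_l i : sZ i i = i + 1. Proof. by rewrite sZE eqxx. Qed.
Lemma sZ_r i : sZ i (i + 1) = i.
Proof. by rewrite sZE eqxx ifF //; apply/eqP; lia. Qed.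
Lemma sZ_id i j : j != i -> j != i + 1 -> sZ i j = j.
Proof. by rewrite sZE => /negPf -> /negPf ->. Qed.

Lemma sw_braid (i : int) F : sw i (sw (i + 1) (sw i F)) = sw (i + 1) (sw i (sw (i + 1) F)).
Proof.
apply/fpsP => m; rewrite !swE; apply: (congr1 F); apply: monomP => k.
rewrite !mswE; apply: (congr1 m).
have a : sZ i (i + 1 + 1) = i + 1 + 1 by apply: sZ_id; apply/eqP; lia.
have b : sZ (i + 1) i = i by apply: sZ_id; apply/eqP; lia.
case: (eqVneq k i) => [->|ki]; first by rewrite !sZ_l a b !sZ_l.
case: (eqVneq k (i + 1)) => [->|ki1]; first by rewrite sZ_r b sZ_l sZ_l a sZ_r.
case: (eqVneq k (i + 1 + 1)) => [->|ki2]; first by rewrite a !sZ_r b.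
by rewrite !sZ_id.
Qed.

(** * Divided differences of power series *)

(** The coefficient at x_i m equates [F m] with the coefficient of F at x_i m / x_j, or with 0 if
    x_j does not occur in m; hence the induction on the exponent of x_j. *)
Lemma XB_reg (i j : int) (F : fps) : i != j -> (X i - X j) * F = 0 -> F = 0.
Proof.
move=> ij XF; apply/fpsP => m; change (F m = 0).
have [n le_n] := ubnP (m j); elim: n m le_n => [//|n IHn] m le_n.
have : ((X i - X j) * F) (mmul (ucm i) m) = 0 by rewrite XF.
rewrite mulrBl fpsBE !X_mulE !cmM !cmU eqxx (negPf ij) add0n /=.
have -> : divcm (mmul (ucm i) m) (ucm i) = m.
  by apply: monomP => k; rewrite divcmE cmM addKn.
case: eqP => [_|mj]; first by rewrite subr0.
rewrite [F (divcm _ _)]IHn ?subr0 // divcmE cmM !cmU eqxx (negPf ij) /= add0n.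
by move: le_n mj; case: (m j) => [|p] // p_n _; rewrite subn1.
Qed.

Lemma XB_inj (i j : int) : i != j -> injective ( *%R (X i - X j)).
Proof.
move=> ij F G /eqP; rewrite -subr_eq0 -mulrBr => /eqP /(XB_reg ij) /eqP.
by rewrite subr_eq0 => /eqP.
Qed.

Definition mset (m : monom) (i : int) (p : nat) : monom :=
  mkcmonom [fsfun j in i |` finsupp m => if j == i then p else m j | 0%N]%fset.

Lemma msetE m i p j : mset m i p j = if j == i then p else m j.
Proof.
rewrite /mset cmE fsfun_fun !inE; case: eqP => //= ji.
by case: (mdomP m j).
Qed.

(* The coefficients of [(F - s_i F) / (x_i - x_(i + 1))], obtained by solving the
   recursion [G(p - 1, q) - G(p, q - 1) = (F - s_i F)(p, q)], where [p] and [q] are the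
   exponents of [x_i] and [x_(i + 1)]. *)
HB.lock Definition dd (i : int) (F : fps) : fps := fun m =>
  \sum_(j < (m (i + 1)).+1)
    (F - sw i F) (mset (mset m i (m i + j).+1) (i + 1) (m (i + 1) - j)).

Lemma ddE i F m : dd i F m = \sum_(j < (m (i + 1)).+1)
  (F - sw i F) (mset (mset m i (m i + j).+1) (i + 1) (m (i + 1) - j)).
Proof. by rewrite dd.unlock. Qed.

(** F - s_i F is antisymmetric in the exponents of x_i and x_(i + 1). The two sums produced by the
    factor x_i - x_(i + 1) telescope; if x_i does not occur in m, the sum along a whole antidiagonal
    is needed, and antisymmetry makes it vanish. *)
Lemma dd_eq (i : int) F : (X i - X (i + 1)) * dd i F = F - sw i F.
Proof.
have ne1 : (i + 1 == i) = false by apply/eqP; lia.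
have ne2 : (i == i + 1) = false by rewrite eq_sym.
apply/fpsP => m; set H := F - sw i F.
pose A (p q : nat) := H (mset (mset m i p) (i + 1) q).
have HE (p q : nat) (m' : monom) : m' i = p -> m' (i + 1) = q ->
    (forall j : int, j != i -> j != i + 1 -> m' j = m j) ->
    H m' = A p q.
  move=> mi mi1 mj; apply: (congr1 H); apply: monomP => j; rewrite !msetE.
  case: eqP => [->//|/eqP ?]; case: eqP => [->//|/eqP ?]; exact: mj.
have ddEm (p q : nat) (m' : monom) : m' i = p -> m' (i + 1) = q ->
    (forall j : int, j != i -> j != i + 1 -> m' j = m j) ->
    dd i F m' = \sum_(j < q.+1) A (p + j)%N.+1 (q - j)%N.
  move=> mi mi1 mj; rewrite ddE mi mi1; apply: eq_bigr => j _.
  apply: HE => [||k k1 k2]; rewrite !msetE ?eqxx ?ne1 ?ne2 //.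
  by rewrite (negPf k1) (negPf k2) mj.
have Aanti (p q : nat) : A p q = - A q p.
  rewrite /A /H !fpsBE !swE opprB; congr (_ - _); apply: (congr1 F); apply: monomP => j.
    by rewrite mswE !msetE sZE; case_ifs; try lia; apply: (congr1 m); lia.
  by rewrite mswE !msetE sZE; case_ifs; try lia; apply: (congr1 m); lia.
rewrite (HE _ _ m erefl erefl) // mulrBl fpsBE !X_mulE.
have d1 : m i != 0%N -> dd i F (divcm m (ucm i)) =
    A (m i) (m (i + 1)) + \sum_(j < m (i + 1)) A (m i + j)%N.+1 (m (i + 1)%R - j.+1)%N.
  move=> mi; rewrite (@ddEm (m i).-1 (m (i + 1))) ?divcmE ?cmU ?eqxx ?ne1 ?ne2 ?subn1 ?subn0 //.
    rewrite big_ord_recl subn0 addn0 prednK ?lt0n //; congr (_ + _).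
    by apply: eq_bigr => j _; rewrite lift0 addnS -addSn prednK ?lt0n.
  by move=> j /negPf ji _; rewrite divcmE cmU eq_sym ji subn0.
have d2 : m (i + 1) != 0%N -> dd i F (divcm m (ucm (i + 1))) =
    \sum_(j < m (i + 1)) A (m i + j)%N.+1 (m (i + 1)%R - j.+1)%N.
  move=> mi; rewrite (@ddEm (m i) (m (i + 1)).-1) ?divcmE ?cmU ?eqxx ?ne1 ?ne2 ?subn1 ?subn0 //.
    rewrite prednK ?lt0n //.
    by apply: eq_bigr => j _; rewrite -subn1 -subnDA add1n.
  by move=> j _ /negPf ji; rewrite divcmE cmU eq_sym ji subn0.
case: (eqVneq (m i) 0%N) => [mi|mi].
  case: (eqVneq (m (i + 1)) 0%N) => [mi1|mi1].
    have := Aanti 0%N 0%N; rewrite mi mi1 /=; lra.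
  rewrite d2 // mi /= sub0r.
  have : \sum_(j < (m (i + 1)).+1) A j (m (i + 1)%R - j)%N = 0.
    set S := (X in X = _); suff : S = - S by lra.
    rewrite {1}/S (reindex_inj rev_ord_inj) /= /S -sumrN; apply: eq_bigr => j _.
    by rewrite Aanti; rewrite !subSS subKn // -ltnS.
  rewrite big_ord_recl subn0 /= => /eqP; rewrite addr_eq0 => /eqP ->; congr (- _).
rewrite d1 //; case: (eqVneq (m (i + 1)) 0%N) => [mi1|mi1].
  by rewrite mi1 big_ord0 addr0 subr0.
by rewrite d2 // addrK.
Qed.

(** By [XB_reg] a divided difference can be computed by exhibiting a solution of its defining
    equation. *)
Lemma dd_uniq (i : int) F G : (X i - X (i + 1)) * G = F - sw i F -> dd i F = G.
Proof. rewrite -dd_eq => H; apply: esym; apply: (@XB_inj i (i + 1)) => //; apply/eqP; lia. Qed.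

(** The source of all bounds on the degree and the variables of [dd i F]. *)
Lemma dd_supp (i : int) F (m : monom) : dd i F m != 0 ->
  exists m', [/\ F m' != 0, mdeg m' = (mdeg m).+1 &
  forall j : int, j != i -> j != i + 1 -> m' j = m j].
Proof.
move=> /eqP dF; apply: contrapT => nF; apply: dF; rewrite ddE big1 // => j _.
have F0 m1 : mdeg m1 = (mdeg m).+1 -> (forall k : int, k != i -> k != i + 1 -> m1 k = m k) ->
    F m1 = 0.
  by move=> d1 mk; apply/eqP; apply: contrapT => /negP F1; apply: nF; exists m1.
set m' := mset _ _ _.
have m'E k : k != i -> k != i + 1 -> m' k = m k.
  by move=> k1 k2; rewrite /m' !msetE (negPf k1) (negPf k2).
have ne1 : (i == i + 1) = false by apply/eqP; lia.
have m'deg : mdeg m' = (mdeg m).+1.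
  have /(congr1 mdeg) : mmul m' (expcmn (ucm (i + 1)) j) = mmul m (expcmn (ucm i) j.+1).
    apply: monomP => k; rewrite !cmM !expcmnE !cmU /m' !msetE.
    have [->|k1] := eqVneq k (i + 1).
      by rewrite ?eqxx ?ne1 muln1 muln0 addn0 subnK // -ltnS.
    rewrite muln0 addn0.
    by have [->|_] := eqVneq k i; rewrite ?muln1 ?addnS // muln0 addn0.
  by rewrite !mdegM !mdeg_expU addnS -addSn => /addIn.
rewrite fpsBE swE !F0 ?subr0 ?mdeg_msw // => k k1 k2.
by rewrite mswE sZ_id ?m'E.
Qed.

(** * The nil-Coxeter relations *)

Lemma dd_sw_id i F : sw i F = F -> dd i F = 0.
Proof. by move=> sF; apply: dd_uniq; rewrite sF subrr mulr0. Qed.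

Lemma dd_eq0 (i : int) F : dd i F = 0 -> sw i F = F.
Proof. by move=> dF; apply/esym/eqP; rewrite -subr_eq0 -dd_eq dF mulr0. Qed.

Lemma sw_XB (i : int) : sw i (X i - X (i + 1)) = - (X i - X (i + 1)).
Proof. by rewrite swB !swX sZ_l sZ_r opprB. Qed.

Lemma sw_dd (i : int) F : sw i (dd i F) = dd i F.
Proof.
apply/esym/dd_uniq; have := congr1 (sw i) (dd_eq i F).
rewrite swM sw_XB swB swK => H; rewrite -[F - _]opprB -H mulNr opprK //.
Qed.

Lemma dd_dd i F : dd i (dd i F) = 0.
Proof. exact/dd_sw_id/sw_dd. Qed.

Lemma ddB (i : int) F G : dd i (F - G) = dd i F - dd i G.
Proof. by apply: dd_uniq; rewrite mulrBr !dd_eq swB; ring. Qed.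

Lemma dd0 i : dd i 0 = 0.
Proof. by apply: dd_sw_id; rewrite sw.unlock. Qed.

Lemma ddD (i : int) F G : dd i (F + G) = dd i F + dd i G.
Proof. by apply: dd_uniq; rewrite mulrDr !dd_eq swD; ring. Qed.

Lemma ddZ (i : int) c F : dd i (c *: F) = c *: dd i F.
Proof.
by apply: dd_uniq; rewrite -scalerAr dd_eq scalerBr sw.unlock renZ.
Qed.

Lemma ddMl (i : int) G F : sw i G = G -> dd i (G * F) = G * dd i F.
Proof.
by move=> sG; apply: dd_uniq; rewrite mulrCA dd_eq swM sG; ring.
Qed.

Lemma dd_sum i (T : Type) (s : seq T) (P : pred T) (F : T -> fps) :
  dd i (\sum_(j <- s | P j) F j) = \sum_(j <- s | P j) dd i (F j).
Proof. by apply: (big_morph (dd i)) => [F' G|]; rewrite ?ddD ?dd0. Qed.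

Lemma dd_sw_comm (i j : int) F : i + 1 < j -> sw i (dd j F) = dd j (sw i F).
Proof.
move=> ij; apply/esym/dd_uniq; have := congr1 (sw i) (dd_eq j F).
rewrite swM !swB !swX !sZ_id; try by apply/eqP; lia.
by move=> ->; rewrite (sw_comm _ ij).
Qed.

Lemma dd_sw_comm' (i j : int) F : i + 1 < j -> sw j (dd i F) = dd i (sw j F).
Proof.
move=> ij; apply/esym/dd_uniq; have := congr1 (sw j) (dd_eq i F).
rewrite swM !swB !swX !sZ_id; try by apply/eqP; lia.
by move=> ->; rewrite (sw_comm _ ij).
Qed.

Lemma dd_comm (i j : int) F : i + 1 < j -> dd i (dd j F) = dd j (dd i F).
Proof.
move=> ij; apply: dd_uniq; have Hj := dd_eq j; have Hi := dd_eq i.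
apply: (@XB_inj j (j + 1)); first by apply/eqP; lia.
rewrite mulrCA Hj mulrBr Hi dd_sw_comm' // Hi.
by rewrite mulrBr dd_sw_comm // !Hj (sw_comm _ ij); ring.
Qed.

(** The Vandermonde product of the three variables turns the operator into the signed sum over their
    six permutations. The other braid word gives the same sum by [sw_braid]. *)
Lemma dd_braid_aux (i : int) F :
  (X i - X (i + 1)) * (X i - X (i + 1 + 1)) * (X (i + 1) - X (i + 1 + 1)) *
    dd i (dd (i + 1) (dd i F)) =
  F - sw i F - sw (i + 1) F + sw (i + 1) (sw i F) + sw i (sw (i + 1) F)
    - sw i (sw (i + 1) (sw i F)).
Proof.
have ne : i != i + 1 by apply/eqP; lia.
set a := X i; set b := X (i + 1); set c := X (i + 1 + 1).
have s1a : sw i a = b by rewrite swX sZ_l.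
have s1b : sw i b = a by rewrite swX sZ_r.
have s1c : sw i c = c by rewrite swX sZ_id //; apply/eqP; lia.
have s2a : sw (i + 1) a = a by rewrite swX sZ_id //; apply/eqP; lia.
have s2b : sw (i + 1) b = c by rewrite swX sZ_l.
have s2c : sw (i + 1) c = b by rewrite swX sZ_r.
set G := dd i F; set H := dd (i + 1) G; set K := dd i H.
have eG : (a - b) * G = F - sw i F := dd_eq i F.
have eH : (b - c) * H = G - sw (i + 1) G := dd_eq (i + 1) G.
have eK : (a - b) * K = H - sw i H := dd_eq i H.
have esG : (a - c) * sw (i + 1) G = sw (i + 1) F - sw (i + 1) (sw i F).
  by have := congr1 (sw (i + 1)) eG; rewrite swM !swB s2a s2b.
have eD : (a - b) * (a - c) * (b - c) * H =
    (a - c) * (F - sw i F) - (a - b) * (sw (i + 1) F - sw (i + 1) (sw i F)).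
  by rewrite -mulrA eH -eG -esG; ring.
have := congr1 (sw i) eD; rewrite !swM !swB !swM !swB s1a s1b s1c swK => esD.
apply: (XB_inj ne); rewrite -/a -/b.
transitivity ((a - b) * (a - c) * (b - c) * H + (b - a) * (b - c) * (a - c) * sw i H).
  have -> : (a - b) * ((a - b) * (a - c) * (b - c) * K) =
    (a - b) * (a - c) * (b - c) * ((a - b) * K) by ring.
  by rewrite eK; ring.
rewrite eD esD; ring.
Qed.

Lemma dd_braid_aux' (i : int) F :
  (X i - X (i + 1)) * (X i - X (i + 1 + 1)) * (X (i + 1) - X (i + 1 + 1)) *
    dd (i + 1) (dd i (dd (i + 1) F)) =
  F - sw i F - sw (i + 1) F + sw (i + 1) (sw i F) + sw i (sw (i + 1) F)
    - sw i (sw (i + 1) (sw i F)).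
Proof.
have ne : i + 1 != i + 1 + 1 by apply/eqP; lia.
rewrite sw_braid.
set a := X i; set b := X (i + 1); set c := X (i + 1 + 1).
have s1a : sw i a = b by rewrite swX sZ_l.
have s1b : sw i b = a by rewrite swX sZ_r.
have s1c : sw i c = c by rewrite swX sZ_id //; apply/eqP; lia.
have s2a : sw (i + 1) a = a by rewrite swX sZ_id //; apply/eqP; lia.
have s2b : sw (i + 1) b = c by rewrite swX sZ_l.
have s2c : sw (i + 1) c = b by rewrite swX sZ_r.
set G := dd (i + 1) F; set H := dd i G; set K := dd (i + 1) H.
have eG : (b - c) * G = F - sw (i + 1) F := dd_eq (i + 1) F.
have eH : (a - b) * H = G - sw i G := dd_eq i G.
have eK : (b - c) * K = H - sw (i + 1) H := dd_eq (i + 1) H.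
have esG : (a - c) * sw i G = sw i F - sw i (sw (i + 1) F).
  by have := congr1 (sw i) eG; rewrite swM !swB s1b s1c.
have eD : (a - b) * (a - c) * (b - c) * H =
    (a - c) * (F - sw (i + 1) F) - (b - c) * (sw i F - sw i (sw (i + 1) F)).
  have -> : (a - b) * (a - c) * (b - c) * H = (a - c) * (b - c) * ((a - b) * H) by ring.
  by rewrite eH -eG -esG; ring.
have := congr1 (sw (i + 1)) eD; rewrite !swM !swB !swM !swB s2a s2b s2c swK => esD.
apply: (XB_inj ne); rewrite -/b -/c.
transitivity ((a - b) * (a - c) * (b - c) * H + (a - c) * (a - b) * (c - b) * sw (i + 1) H).
  have -> : (b - c) * ((a - b) * (a - c) * (b - c) * K) =
    (a - b) * (a - c) * (b - c) * ((b - c) * K) by ring.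
  by rewrite eK; ring.
rewrite eD esD; ring.
Qed.

Lemma dd_braid (i : int) F :
  dd i (dd (i + 1) (dd i F)) = dd (i + 1) (dd i (dd (i + 1) F)).
Proof.
have n1 : i != i + 1 by apply/eqP; lia.
have n2 : i != i + 1 + 1 by apply/eqP; lia.
have n3 : i + 1 != i + 1 + 1 by apply/eqP; lia.
apply: (XB_inj n3); apply: (XB_inj n2); apply: (XB_inj n1).
by have := dd_braid_aux i F; rewrite -dd_braid_aux' -!mulrA.
Qed.

(** * Elementary symmetric functions *)

Lemma elemsymP (k : int) d (m : monom) :
  reflect (mdeg m = d /\ forall i : int, m i != 0%N -> (i <= k) && (m i == 1%N))
    (elemsym k d m != 0).
Proof.
rewrite /elemsym pnatr_eq0 eqb0 negbK; apply: (iffP andP) => [[/eqP dm /allP H]|[dm H]].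
  by split=> // i; rewrite cmE_neq0 => /H.
by split; [apply/eqP|apply/allP => i; rewrite -cmE_neq0 => /H].
Qed.

Lemma elemsym_eq (k k' : int) d d' (m m' : monom) :
  (elemsym k d m != 0) = (elemsym k' d' m' != 0) -> elemsym k d m = elemsym k' d' m'.
Proof. by rewrite /elemsym !pnatr_eq0 !eqb0 !negbK => ->. Qed.

Lemma elemsym0 (k : int) : elemsym k 0 = 1.
Proof.
apply/fpsP => m; rewrite fps1E; congr (_%:R); congr nat_of_bool.
rewrite -mdeg_eq0; case: eqP => [/mdeg_eq0I ->|//].
by rewrite mdom1; apply/allP => i; rewrite in_fset0.
Qed.

Lemma mdivK (m : monom) i : m i != 0%N -> mmul (ucm i) (divcm m (ucm i)) = m.
Proof.
move=> mi; apply: monomP => j; rewrite cmM divcmE cmU; case: eqP => [<-|_].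
  by rewrite subnKC // lt0n.
by rewrite subn0.
Qed.

Lemma elemsymS (k : int) d :
  elemsym k d.+1 = elemsym (k - 1) d.+1 + X k * elemsym (k - 1) d.
Proof.
apply/fpsP => m; rewrite fpsDE X_mulE; case: ifPn => [/eqP mk|mk].
  rewrite addr0; apply: elemsym_eq; apply/elemsymP/elemsymP => -[dm H]; split=> // i mi.
    have /andP[ik ->] := H i mi; rewrite andbT.
    have : i != k by apply: contraNneq mi => ->; rewrite mk.
    lia.
  by have /andP[ik ->] := H i mi; rewrite andbT; lia.
have -> : elemsym (k - 1) d.+1 m = 0.
  apply/eqP; apply: contrapT => /negP /elemsymP[_ /(_ k mk) /andP[+ _]]; lia.
rewrite add0r; apply: elemsym_eq.
have dm : mdeg m = (mdeg (divcm m (ucm k))).+1.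
  by rewrite -{1}(mdivK mk) mdegM mdegU.
have dE (i : int) : i != k -> divcm m (ucm k) i = m i.
  by move=> ik; rewrite divcmE cmU eq_sym (negPf ik) subn0.
apply/elemsymP/elemsymP => -[dm' H]; split.
- by move: dm'; rewrite dm => -[].
- move=> i mi; have [ik|ik] := eqVneq i k.
    have /andP[_ /eqP mk1] := H k mk.
    by move: mi; rewrite ik divcmE cmUU mk1.
  move: mi; rewrite dE // => /H /andP[? ->]; rewrite andbT; lia.
- by rewrite dm dm'.
move=> i mi; have [->|ik] := eqVneq i k.
  rewrite lexx /=; case: (eqVneq (divcm m (ucm k) k) 0%N) => [|/H /andP[]]; last lia.
  by rewrite divcmE cmUU => /eqP; rewrite subn_eq0 eqn_leq => ->; rewrite lt0n.
move: mi; rewrite -dE // => /H /andP[? ->]; rewrite andbT; lia.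
Qed.

Lemma sw_elemsym (i k : int) d : i != k -> sw i (elemsym k d) = elemsym k d.
Proof.
move=> ik; apply/fpsP => m; rewrite swE; apply: elemsym_eq.
have sk j : (sZ i j <= k) = (j <= k) by rewrite sZE; case_ifs; lia.
apply/elemsymP/elemsymP; rewrite mdeg_msw => -[dm H]; split=> // j.
  by rewrite -{1 3}(sZK i j) -mswE => /H; rewrite sk.
by rewrite mswE => /H; rewrite sk.
Qed.

(** In [elemsymS] only the factor x_k is moved by s_k. *)
Lemma dd_elemsym (k : int) d : dd k (elemsym k d.+1) = elemsym (k - 1) d.
Proof.
have kk : k != k - 1 by apply/eqP; lia.
apply: dd_uniq; rewrite elemsymS swD swM !sw_elemsym // swX sZ_l; ring.
Qed.

(** Through this identity the variables act on the span of the elementary monomials. *)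
Lemma X_elemsym (k : int) : X k = elemsym k 1 - elemsym (k - 1) 1.
Proof. by rewrite elemsymS elemsym0; ring. Qed.

(** * Degrees and variables *)

Definition homog (d : nat) (F : fps) := forall m : monom, F m != 0 -> mdeg m = d.

Definition deg_le (d : nat) (F : fps) := forall m : monom, F m != 0 -> (mdeg m <= d)%N.

Definition vars_le (b : int) (F : fps) :=
  forall (m : monom) (i : int), F m != 0 -> b < i -> m i = 0%N.

Lemma homog_elemsym k d : homog d (elemsym k d).
Proof. by move=> m /elemsymP[]. Qed.

Lemma vars_le_elemsym k d : vars_le k (elemsym k d).
Proof.
move=> m i /elemsymP[_ H] ki; apply/eqP; apply: contrapT => /negP /H; lia.
Qed.

Lemma homog_deg d F : homog d F -> deg_le d F.
Proof. by move=> hF m /hF ->. Qed.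

Lemma homogM d e F G : homog d F -> homog e G -> homog (d + e) (F * G).
Proof.
by move=> hF hG m /fps_mul_neq0[a [b [<- /hF da /hG db]]]; rewrite mdegM da db.
Qed.

Lemma homog1 : homog 0 1.
Proof. by move=> m; rewrite fps1E pnatr_eq0 eqb0 negbK => /eqP ->; rewrite mdeg1. Qed.

Lemma fpsD_neq0 (F G : fps) m : (F + G) m != 0 -> F m != 0 \/ G m != 0.
Proof.
rewrite fpsDE; have [->|] := eqVneq (F m) 0; last by left.
by rewrite add0r; right.
Qed.

Lemma fpsZ_neq0 c (F : fps) m : (c *: F) m != 0 -> F m != 0.
Proof. by rewrite fpsZE mulf_eq0 negb_or => /andP[]. Qed.

Lemma fpsN_neq0 (F : fps) m : (- F) m != 0 -> F m != 0.
Proof. by rewrite fpsNE oppr_eq0. Qed.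

Lemma deg_leM d e F G : deg_le d F -> deg_le e G -> deg_le (d + e) (F * G).
Proof.
by move=> hF hG m /fps_mul_neq0[a [b [<- /hF da /hG db]]]; rewrite mdegM leq_add.
Qed.

Lemma vars_leM b F G : vars_le b F -> vars_le b G -> vars_le b (F * G).
Proof.
by move=> hF hG m i /fps_mul_neq0[a [c [<- Fa Gc]]] bi; rewrite cmM (hF _ _ Fa) // (hG _ _ Gc).
Qed.

Lemma vars_leD b F G : vars_le b F -> vars_le b G -> vars_le b (F + G).
Proof. by move=> hF hG m i /fpsD_neq0[/hF|/hG]; apply. Qed.

Lemma vars_leS (b c : int) F : b <= c -> vars_le b F -> vars_le c F.
Proof. by move=> bc hF m i Fm ci; apply: hF Fm _; lia. Qed.

Lemma dd_homog0 i F : homog 0 F -> dd i F = 0.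
Proof.
move=> hF; apply/fpsP => m; apply/eqP; apply: contrapT => /negP /dd_supp[m' [/hF d0]].
by rewrite d0.
Qed.

Lemma dd_homog i d F : homog d.+1 F -> homog d (dd i F).
Proof. by move=> hF m /dd_supp[m' [/hF -> [->]]]. Qed.

Lemma dd_deg_le i d F : deg_le d.+1 F -> deg_le d (dd i F).
Proof. by move=> hF m /dd_supp[m' [/hF + dm]]; rewrite dm. Qed.

Lemma dd_deg0 i F : deg_le 0 F -> dd i F = 0.
Proof.
by move=> hF; apply: dd_homog0 => m /hF; rewrite leqn0 => /eqP.
Qed.

Lemma sw_vars_le (b i : int) F : vars_le b F -> b < i -> sw i F = F.
Proof.
move=> hF bi; apply/fpsP => m; rewrite swE.
have [E|] := eqVneq (msw i m) m; first by rewrite E.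
move=> ne; have Fm m' : msw i m' != m' -> F m' = 0.
  move=> ne'; apply/eqP; apply: contrapT => /negP Fm'; move/negP: ne'; apply.
  apply/cmP => j; rewrite mswE sZE; case: eqP => [->|_].
    by rewrite !(hF _ _ Fm') //; lia.
  by case: eqP => [->|//]; rewrite !(hF _ _ Fm') //; lia.
rewrite !Fm // mswK eq_sym //.
Qed.

Lemma dd_vars_le (b i : int) F : vars_le b F -> i < b -> vars_le b (dd i F).
Proof.
move=> hF ib m j /dd_supp[m' [Fm' _ H]] bj; rewrite -H ?(hF _ _ Fm') //; apply/eqP; lia.
Qed.

(** * Back stable power series *)

(* The last condition is symmetry in the variables [x_i] with [i <= a]: [i = a - 1] is the
   last swap allowed. *)
Definition stable (a b : int) (d : nat) (F : fps) :=
  [/\ deg_le d F, vars_le b F & forall i : int, i < a -> sw i F = F].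

Lemma stableS (a a' b b' : int) (d d' : nat) F : a' <= a -> b <= b' -> (d <= d')%N ->
  stable a b d F -> stable a' b' d' F.
Proof.
move=> aa bb dd [hd hb ha]; split=> [m /hd dm|m i Fm bi|i ia].
- exact: leq_trans dm dd.
- by apply: hb Fm _; lia.
by apply: ha; lia.
Qed.

Lemma stableD (a b : int) d F G : stable a b d F -> stable a b d G -> stable a b d (F + G).
Proof.
move=> [dF bF aF] [dG bG aG]; split.
- by move=> m /fpsD_neq0[/dF|/dG].
- exact: vars_leD.
by move=> i ia; rewrite swD aF ?aG.
Qed.

Lemma stableZ (a b : int) d c F : stable a b d F -> stable a b d (c *: F).
Proof.
move=> [dF bF aF]; split; first by move=> m /fpsZ_neq0 /dF.
  by move=> m i /fpsZ_neq0 /bF; apply.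
by move=> i ia; rewrite -[in RHS](aF i ia) sw.unlock.
Qed.

Lemma stableM (a b : int) d e F G :
  stable a b d F -> stable a b e G -> stable a b (d + e) (F * G).
Proof.
move=> [dF bF aF] [dG bG aG]; split.
- exact: deg_leM.
- exact: vars_leM.
by move=> i ia; rewrite swM aF ?aG.
Qed.

(** [dd i] commutes with s_j for j + 1 < i, which gives the bound i - 1, and it may introduce x_(i +
    1). *)
Lemma stable_dd (a b i : int) d F : stable a b d.+1 F ->
  stable (Order.min a (i - 1)) (Order.max b (i + 1)) d (dd i F).
Proof.
move=> [dF bF aF]; split.
- exact: dd_deg_le.
- apply: dd_vars_le; last lia.
  by apply: vars_leS bF; lia.
by move=> j; rewrite lt_min => /andP[ja ji]; rewrite dd_sw_comm ?aF //; lia.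
Qed.

Lemma dd_stable0 (a b i : int) d F : stable a b d F -> (i < a) || (b < i) -> dd i F = 0.
Proof.
by move=> [dF bF aF] /orP[/aF|/(sw_vars_le bF)] sF; apply: dd_sw_id.
Qed.

(* A variable that can be swapped with all larger ones would produce arbitrarily large
   variables. *)
Lemma sym_vars_lt (a b : int) F : vars_le b F -> (forall i : int, a <= i -> sw i F = F) ->
  forall (m : monom) (i : int), F m != 0 -> a <= i -> m i = 0%N.
Proof.
move=> bF aF; suff H n : forall (m : monom) (i : int),
    F m != 0 -> a <= i -> b - n%:Z < i -> m i = 0%N.
  by move=> m i Fm ai; apply: (H (absz (b - i)).+1) => //; lia.
elim: n => [|n IHn] m i Fm ai bi; first by apply: bF Fm _; lia.
have [|bi'] := ltP (b - n%:Z) i; first exact: IHn.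
have <- : msw i m (i + 1) = m i by rewrite mswE sZ_r.
apply: IHn; [|lia|lia].
by rewrite -swE aF.
Qed.

(** * Permutations of the integers *)

Lemma permZ_mulE (u v : permZ) i : (u * v)%g i = u (v i). Proof. by []. Qed.
Lemma permZ_1E i : (1%g : permZ) i = i. Proof. by []. Qed.

Lemma permZ_inj (w : permZ) : injective w.
Proof. exact: bij_inj (permZ_bij w). Qed.

Lemma permZ_VK (w : permZ) : cancel w (w^-1)%g.
Proof. by move=> i; rewrite -permZ_mulE mulVg. Qed.

Lemma permZ_KV (w : permZ) : cancel (w^-1)%g w.
Proof. by move=> i; rewrite -permZ_mulE mulgV. Qed.

Lemma sZ_mulK (w : permZ) i : (w * sZ i * sZ i)%g = w.
Proof. by apply: permZ_ext => j; rewrite !permZ_mulE sZK. Qed.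

Definition desc (w : permZ) (i : int) := w (i + 1) < w i.

Lemma permZ_ltNge (w : permZ) (i j : int) : i != j -> (w i < w j) = ~~ (w j < w i).
Proof. by move=> ij; rewrite -leNgt lt_neqAle (inj_eq (@permZ_inj w)) ij. Qed.

Lemma desc_mulN (w : permZ) i : desc (w * sZ i)%g i = ~~ desc w i.
Proof.
by rewrite /desc !permZ_mulE sZ_l sZ_r permZ_ltNge //; apply/eqP; lia.
Qed.

Lemma desc_mul_far (w : permZ) (i j : int) : (i + 1 < j) || (j + 1 < i) ->
  desc (w * sZ i)%g j = desc w j.
Proof.
by move=> ij; rewrite /desc !permZ_mulE !sZ_id //; apply/eqP; lia.
Qed.

Lemma int_finite_bound (A : set int) : finite_set A ->
  exists N : nat, forall i : int, A i -> (absz i <= N)%N.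
Proof.
move=> /finite_fsetP[B ->]; exists (\sum_(i <- B) absz i)%N => i /= iB.
by rewrite (big_fsetD1 i) //= leq_addr.
Qed.

Lemma permZ_bound (w : permZ) : exists N : nat, forall i : int, (N < absz i)%N -> w i = i.
Proof.
have [N HN] := int_finite_bound (permZ_fin w).
by exists N => i Ni; apply: contrapT => /HN; lia.
Qed.

Definition invs (w : permZ) : set (int * int) :=
  [set p | (p.1 < p.2) && (w p.2 < w p.1)].

Lemma finite_invs (w : permZ) : finite_set (invs w).
Proof.
have [N HN] := permZ_bound w.
pose I : set int := (fun k : nat => k%:Z - N%:Z) @` `I_(N + N).+1.
have fI : finite_set I by apply/finite_image/finite_II.
have inI (i : int) : - N%:Z <= i <= N%:Z -> I i.
  by move=> iN; exists (absz (i + N%:Z)) => /=; lia.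
apply: sub_finite_set (finite_setX fI fI) => -[a b] /= /andP[/= ab wab].
have wI (i : int) : w (w i) = w i -> w i = i by apply: permZ_inj.
(* If a < -N, then w b < w a = a < -N, so w b is a fixed point and equals b, against a < b. The
   bound for b is symmetric. *)
have aN : - N%:Z <= a.
  rewrite leNgt; apply/negP => aN; have wa : w a = a by apply: HN; lia.
  by have := wI b; rewrite (HN (w b)) // => [/(_ erefl)|]; lia.
have bN : b <= N%:Z.
  rewrite leNgt; apply/negP => bN; have wb : w b = b by apply: HN; lia.
  by have := wI a; rewrite (HN (w a)) // => [/(_ erefl)|]; lia.
by split; apply: inI; lia.
Qed.

Definition ninv (w : permZ) : nat := #|` fset_set (invs w) |.

Lemma in_invs (w : permZ) (a b : int) :
  ((a, b) \in fset_set (invs w)) = (a < b) && (w b < w a).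
Proof.
by rewrite in_fset_set; [apply/idP/idP; rewrite inE|exact: finite_invs].
Qed.

Lemma sZ_lt (i a b : int) : (a, b) != (i, i + 1) -> a < b -> sZ i a < sZ i b.
Proof.
by rewrite xpair_eqE !sZE; case_ifs; rewrite ?andbT ?andbF //=; lia.
Qed.

(** s_i preserves the order of every pair except (i, i + 1). So the inversions of w s_i are the
    images of those of w, together with this pair. *)
Lemma ninv_asc (w : permZ) i : ~~ desc w i -> ninv (w * sZ i)%g = (ninv w).+1.
Proof.
move=> asc; rewrite /ninv.
pose q : int * int := (i, i + 1).
pose f (p : int * int) := (sZ i p.1, sZ i p.2).
have fK : involutive f by move=> [a b]; rewrite /f /= !sZK.
suff -> : fset_set (invs (w * sZ i)%g) =
    (q |` [fset f p | p in fset_set (invs w)])%fset.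
  rewrite cardfsU1 card_imfset /=; last exact: inv_inj fK.
  suff -> : q \notin [fset f p | p in fset_set (invs w)]%fset by [].
  apply/negP => /imfsetP[[a b]] /=; rewrite in_invs => /andP[ab _] [].
  by rewrite !sZE; case_ifs; lia.
apply/fsetP => -[a b]; rewrite !inE in_invs !permZ_mulE /q.
have -> : ((a, b) \in [fset f p | p in fset_set (invs w)]%fset) =
    (sZ i a < sZ i b) && (w (sZ i b) < w (sZ i a)).
  apply/imfsetP/idP => [[[c d] /=]|H].
    by rewrite in_invs => ? [-> ->]; rewrite !sZK.
  exists (sZ i a, sZ i b); last by rewrite /f /= !sZK.
  by rewrite in_invs.
have [[-> ->]|ne] := eqVneq (a, b) (i, i + 1).
  rewrite /= sZ_l sZ_r permZ_ltNge; first by rewrite asc andbT; lia.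
  by apply/eqP; lia.
rewrite /=; case wba: (w _ < w _); rewrite ?andbF // !andbT.
apply/idP/idP; first exact: sZ_lt.
move=> H; have := @sZ_lt i (sZ i a) (sZ i b); rewrite !sZK.
apply=> //; apply: contraNneq asc => -[sa sb].
by rewrite /desc; rewrite sa sb in wba.
Qed.

Lemma ninv_desc (w : permZ) i : desc w i -> ninv w = (ninv (w * sZ i)%g).+1.
Proof.
by move=> dw; rewrite -(@ninv_asc _ i) ?sZ_mulK // desc_mulN dw.
Qed.

Lemma ninv1 : ninv 1%g = 0%N.
Proof.
apply/eqP; rewrite cardfs_eq0; apply/eqP/fsetP => -[a b].
by rewrite in_invs inE !permZ_1E; lia.
Qed.

(** Such a w is strictly increasing. Starting from fixed points far to the left this gives w i >= i,
    and from fixed points far to the right w i <= i. *)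
Lemma no_desc (w : permZ) : (forall i, ~~ desc w i) -> w = 1%g.
Proof.
move=> nd; have incr i : w i < w (i + 1).
  by rewrite permZ_ltNge; [exact: nd|apply/eqP; lia].
have [N HN] := permZ_bound w.
have up (n : nat) : - (N.+1)%:Z + n%:Z <= w (- (N.+1)%:Z + n%:Z).
  elim: n => [|n IHn]; first by rewrite addr0 HN //; lia.
  have -> : - (N.+1)%:Z + n.+1%:Z = - (N.+1)%:Z + n%:Z + 1 by lia.
  by have := incr (- (N.+1)%:Z + n%:Z); rewrite -lezD1; apply: le_trans; rewrite lerD2r.
have down (n : nat) : w ((N.+1)%:Z - n%:Z) <= (N.+1)%:Z - n%:Z.
  elim: n => [|n IHn]; first by rewrite subr0 HN //; lia.
  have := incr ((N.+1)%:Z - n.+1%:Z).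
  have E : (N.+1)%:Z - n.+1%:Z + 1 = (N.+1)%:Z - n%:Z by lia.
  by rewrite E -lezD1 => /le_trans/(_ IHn); rewrite -E lerD2r.
apply: permZ_ext => i; rewrite permZ_1E.
have [Ni|Ni] := ltnP N (absz i); first exact: HN.
apply/eqP; rewrite eq_le; apply/andP; split.
  have := down (absz ((N.+1)%:Z - i)); have -> : (N.+1)%:Z - (absz ((N.+1)%:Z - i)%R)%:Z = i by lia.
  by [].
have := up (absz ((N.+1)%:Z + i)); have -> : - (N.+1)%:Z + (absz ((N.+1)%:Z + i)%R)%:Z = i by lia.
by [].
Qed.

Lemma exists_desc (w : permZ) : w <> 1%g -> exists i, desc w i.
Proof.
by move=> w1; apply/not_existsP => nd; apply: w1; apply: no_desc => i; apply/negP/nd.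
Qed.

Lemma permZ_ind (P : permZ -> Prop) : P 1%g ->
  (forall w i, desc w i -> P (w * sZ i)%g -> P w) -> forall w, P w.
Proof.
move=> P1 PS w; have [n le_n] := ubnP (ninv w); elim: n w le_n => [//|n IHn] w le_n.
have [w1|w1] := pselect (w = 1%g); first by rewrite w1.
have [i di] := exists_desc w1.
by apply: (PS _ i) => //; apply: IHn; move: le_n; rewrite (ninv_desc di).
Qed.

Lemma ninv_mul_le (w : permZ) i : (ninv (w * sZ i)%g <= (ninv w).+1)%N.
Proof.
case: (boolP (desc w i)) => [/ninv_desc -> //|/ninv_asc -> //]; exact: leqW.
Qed.

(** Each letter of a word adds at most one inversion, and removing descents one at a time spells a
    word with exactly [ninv w] letters. *)
Lemma coxlenE (w : permZ) : coxlen w = ninv w.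
Proof.
have ge n : word_length w n -> (ninv w <= n)%N.
  move=> [s ->]; rewrite -[in leqRHS](size_tuple s); elim/last_ind: (val s) => [|t i IHt].
    by rewrite big_nil ninv1.
  rewrite -cats1 big_cat big_seq1 cats1 size_rcons.
  exact: leq_trans (ninv_mul_le _ _) _.
have wl : word_length w (ninv w).
  elim/permZ_ind: w {ge} => [|w i di [s sE]].
    by rewrite ninv1; exists [tuple]; rewrite big_nil.
  rewrite (ninv_desc di); exists [tuple of rcons s i].
  rewrite /= -cats1 big_cat big_seq1 -sE; apply: esym; exact: sZ_mulK.
have H := @xgetPex _ 0%N [set n | word_length w n /\
  forall k, word_length w k -> (n <= k)%N].
have [] := H; first by exists (ninv w); split.
rewrite -/(coxlen w) => wc cmin; apply/eqP; rewrite eqn_leq cmin //=; exact: ge.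
Qed.

Lemma coxlen_lt (w : permZ) i : (coxlen (w * sZ i)%g < coxlen w)%N = desc w i.
Proof.
rewrite !coxlenE; case: (boolP (desc w i)) => [/ninv_desc ->|/ninv_asc ->]; first exact: ltnSn.
by rewrite ltnNge leqnSn.
Qed.

Lemma desc_max (w : permZ) (N : int) : (forall j, N < j -> w j = j) ->
  forall i, desc w i -> i < N.
Proof.
move=> wN i; apply: contraLR; rewrite -leNgt => Ni.
rewrite /desc -permZ_ltNge; last by apply/eqP; lia.
rewrite [w (i + 1)]wN; last lia.
have [iN|iN] := ltP N i; first by rewrite wN //; lia.
have [|wi] := leP (w i) N; first lia.
by have := permZ_inj (wN _ wi); lia.
Qed.

Lemma desc_min (w : permZ) (a : int) : (forall j, j < a -> w j = j) ->
  forall i, desc w i -> a <= i.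
Proof.
move=> wa i; apply: contraLR; rewrite -ltNge => ia.
rewrite /desc -permZ_ltNge; last by apply/eqP; lia.
rewrite [w i]wa //.
have [ia1|ia1] := ltP (i + 1) a; first by rewrite wa //; lia.
have [|wi] := leP a (w (i + 1)); first lia.
by have := permZ_inj (wa _ wi); lia.
Qed.

(** * The operator attached to a permutation *)

Section Evaluation.

Variables (T : Type) (d : int -> T -> T).
Hypothesis dC : forall (i j : int) x, i + 1 < j -> d i (d j x) = d j (d i x).
Hypothesis dB : forall (i : int) x,
  d i (d (i + 1) (d i x)) = d (i + 1) (d i (d (i + 1) x)).

Let a_desc (w : permZ) : int := xget 0 [set i | desc w i].

Fixpoint eval_rec (n : nat) (x : T) (w : permZ) : T :=
  if n is n'.+1 then d (a_desc w) (eval_rec n' x (w * sZ (a_desc w))%g) else x.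

Definition eval (x : T) (w : permZ) : T := eval_rec (ninv w) x w.

Lemma eval1 x : eval x 1%g = x.
Proof. by rewrite /eval ninv1. Qed.

(* Two descents of [w] generate a dihedral group whose longest element can be split off
   [w]; this replaces Matsumoto's theorem. *)
Lemma eval_desc x w i : desc w i -> eval x w = d i (eval x (w * sZ i)%g).
Proof.
have [n le_n] := ubnP (ninv w); elim: n w le_n i => [//|n IHn] w le_n i di.
have IH v j : desc v j -> (ninv v < ninv w)%N -> eval x v = d j (eval x (v * sZ j)%g).
  by move=> dv vw; apply: IHn => //; apply: leq_trans vw _.
have lt v j : desc v j -> (ninv (v * sZ j)%g < ninv v)%N.
  by move=> /ninv_desc ->.
pose j := a_desc w; have dj : desc w j.
  by apply: (@xgetPex _ 0 [set i | desc w i]); exists i.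
have -> : eval x w = d j (eval x (w * sZ j)%g).
  by rewrite /eval (ninv_desc dj).
clearbody j.
wlog ij : i j di dj / i < j.
  move=> W; have [ij|ji|->//] := ltgtP i j; first exact: W.
  exact/esym/W.
have [ij1|ij1] := ltP (i + 1) j.
  rewrite (IH (w * sZ j)%g i) ?desc_mul_far ?ij1 ?orbT ?lt //.
  rewrite (IH (w * sZ i)%g j) ?desc_mul_far ?ij1 ?orbT ?lt //.
  rewrite -dC //; congr (d _ (d _ (eval _ _))); apply: permZ_ext => k.
  by rewrite !permZ_mulE; congr (w _); rewrite !sZE; case_ifs; lia.
have {ij ij1} jE : j = i + 1 by lia.
rewrite {j}jE in dj *.
have a : sZ i (i + 1 + 1) = i + 1 + 1 by apply: sZ_id; apply/eqP; lia.
have b : sZ (i + 1) i = i by apply: sZ_id; apply/eqP; lia.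
have dd' : w (i + 1 + 1) < w i by apply: lt_trans dj di.
have d1 : desc (w * sZ i)%g (i + 1) by rewrite /desc !permZ_mulE a sZ_r.
have d2 : desc (w * sZ i * sZ (i + 1))%g i by rewrite /desc !permZ_mulE b sZ_l a sZ_l.
have d3 : desc (w * sZ (i + 1))%g i by rewrite /desc !permZ_mulE b sZ_l.
have d4 : desc (w * sZ (i + 1) * sZ i)%g (i + 1) by rewrite /desc !permZ_mulE sZ_r b a sZ_r.
rewrite (IH _ i d3) ?lt // (IH _ (i + 1) d4) ?(ltn_trans (lt _ _ d3)) ?lt //.
rewrite (IH _ (i + 1) d1) ?lt // (IH _ i d2) ?(ltn_trans (lt _ _ d1)) ?lt //.
rewrite dB; congr (d _ (d _ (d _ (eval _ _)))).
apply: permZ_ext => k; rewrite !permZ_mulE; congr (w _).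
case: (eqVneq k i) => [->|ki]; first by rewrite !(a, b, sZ_l, sZ_r).
case: (eqVneq k (i + 1)) => [->|ki1]; first by rewrite !(a, b, sZ_l, sZ_r).
case: (eqVneq k (i + 1 + 1)) => [->|ki2]; first by rewrite !(a, b, sZ_l, sZ_r).
by rewrite !sZ_id.
Qed.

End Evaluation.

(** * Divided differences of polynomials *)

Lemma monom_ind (P : monom -> Prop) : P mone ->
  (forall (i : int) m, P m -> P (mmul (ucm i) m)) -> forall m, P m.
Proof.
move=> P1 PM m; have [n le_n] := ubnP (mdeg m); elim: n m le_n => [//|n IHn] m le_n.
have [m1|/eqP m1] := eqVneq (mdeg m) 0%N; first by rewrite (mdeg_eq0I m1).
have [i im] : exists i : int, m i != 0%N.
  apply/not_existsP => H; apply: m1; rewrite mdegE big1_seq // => i _.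
  by apply/eqP; apply: contrapT => /negP; apply: H.
rewrite -(mdivK im); apply: PM; apply: IHn.
by move: le_n; rewrite -{1}(mdivK im) mdegM mdegU.
Qed.

Lemma monalgUM (a b : monom) : << mmul a b >> = << a >> * << b >> :> polyZ.
Proof. by rewrite malgM_def fgmulUU mulr1. Qed.

Lemma malg_scaleU (c : rat) (m : monom) : << c *g m >> = c *: << m >> :> polyZ.
Proof. by apply/malgP => k; rewrite mcoeffU mcoeffZ mcoeffU1 mulr_natr. Qed.

Lemma fps_monomS (i : int) (m : monom) :
  fps_of_poly << mmul (ucm i) m >> = X i * fps_of_poly << m >>.
Proof. by rewrite X_polyE -[RHS](rmorphM fps_of_poly) /= (monalgUM (ucm i) m). Qed.

Lemma sw_monom (i : int) (m : monom) : msw i m = m ->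
  sw i (fps_of_poly << m >>) = fps_of_poly << m >>.
Proof.
move=> mm; apply/fpsP => k; rewrite swE !fps_of_polyUE.
by rewrite -{1}mm (inj_eq (inv_inj (mswK i))).
Qed.

Lemma fps_poly_ind (Q : fps -> Prop) : Q 0 -> (forall F G, Q F -> Q G -> Q (F + G)) ->
  (forall c F, Q F -> Q (c *: F)) -> Q 1 -> (forall i F, Q F -> Q (X i * F)) ->
  forall p, Q (fps_of_poly p).
Proof.
move=> Q0 QD QZ Q1 QX p; rewrite (monalgE p) raddf_sum /=.
apply: (big_ind Q) => // m _.
rewrite malg_scaleU fps_of_polyZ; apply: QZ; elim/monom_ind: m => [|i m IHm].
  by have := Q1; rewrite -[1](rmorph1 fps_of_poly).
rewrite (fps_monomS i m); exact: QX.
Qed.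

Lemma fps_of_poly_prename (f g : int -> int) (p : polyZ) : cancel f g -> cancel g f ->
  fps_of_poly (prename f p) = ren g (fps_of_poly p).
Proof.
move=> fK gK; apply/fpsP => m; rewrite /ren /fps_of_poly /prename raddf_sum /=.
under eq_bigr => k _ do rewrite mcoeffU.
have E k : (mrename f k == m) = (k == mrename g m).
  by apply/eqP/eqP => [<-|->]; rewrite ?(mrenameK fK gK) ?(mrenameK gK fK).
under eq_bigr => k _ do rewrite E.
have [gm|gm] := boolP (mrename g m \in msupp p).
  rewrite (big_fsetD1 _ gm) /= eqxx mulr1n big1_seq ?addr0 // => k /=.
  by rewrite !inE => /andP[/negPf ->].
rewrite (mcoeff_outdom gm) big1_seq // => k /= kp.
by case: eqP kp gm => [-> ->|].
Qed.

Lemma fps_of_poly_sw (i : int) (p : polyZ) :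
  fps_of_poly (prename (sZ i) p) = sw i (fps_of_poly p).
Proof. by rewrite (fps_of_poly_prename _ (sZK i) (sZK i)) sw.unlock. Qed.

Lemma ddM (i : int) F G : dd i (F * G) = dd i F * G + sw i F * dd i G.
Proof.
apply: dd_uniq; rewrite mulrDr mulrA dd_eq mulrCA dd_eq swM; ring.
Qed.

Lemma ddX (i j : int) : dd i (X j) = ((j == i)%:R - (j == i + 1)%:R)%:A.
Proof.
have i1 : (i == i + 1) = false by apply/eqP; lia.
apply: dd_uniq; rewrite swX; case: (eqVneq j i) => [->|ji].
  by rewrite i1 sZ_l subr0 scale1r mulr1.
case: (eqVneq j (i + 1)) => [->|ji1].
  by rewrite sZ_r sub0r scaleN1r mulrN1 opprB.
by rewrite sZ_id // subrr scale0r mulr0 subrr.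
Qed.

Lemma dd_poly (i : int) (p : polyZ) : exists q : polyZ, dd i (fps_of_poly p) = fps_of_poly q.
Proof.
(* The Leibniz rule for [dd i (X j * F)] contains F itself, so the induction must also record that F
   is a polynomial. *)
suff [] : (exists q, fps_of_poly p = fps_of_poly q) /\
          (exists q, dd i (fps_of_poly p) = fps_of_poly q) by [].
move: p; apply: (@fps_poly_ind (fun F => (exists q, F = fps_of_poly q) /\
  (exists q, dd i F = fps_of_poly q))) =>
  [|F G [[p ->] [p' Hp']] [[q ->] [q' Hq']]|c F [[p ->] [p' Hp']]||j F [[p ->] [p' Hp']]].
- by rewrite dd0; split; exists 0; rewrite raddf0.
- split; first by exists (p + q); rewrite raddfD.
  by exists (p' + q'); rewrite ddD Hp' Hq' raddfD.
- by rewrite ddZ Hp'; split; [exists (c *: p)|exists (c *: p')]; rewrite fps_of_polyZ.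
- rewrite dd_sw_id ?sw1 //; split; first by exists 1; rewrite rmorph1.
  by exists 0; rewrite raddf0.
split; first by exists (var j * p); rewrite rmorphM X_polyE.
rewrite ddM Hp' swX ddX; set c := _ - _.
exists (c *: p + var (sZ i j) * p').
by rewrite raddfD /= rmorphM /= fps_of_polyZ -X_polyE -scalerAl mul1r.
Qed.

(** [divdiff] is a choice among polynomial quotients: [dd_poly] provides one, and [dd_uniq] shows
    that there is no other. *)
Lemma fps_divdiff (i : int) (p : polyZ) : fps_of_poly (divdiff i p) = dd i (fps_of_poly p).
Proof.
have e1 g : fps_of_poly ((var i - var (i + 1)) * g) = (X i - X (i + 1)) * fps_of_poly g.
  by rewrite (rmorphM fps_of_poly) (raddfB fps_of_poly) (X_polyE i) (X_polyE (i + 1)).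
have e2 : fps_of_poly (p - prename (sZ i) p) = fps_of_poly p - sw i (fps_of_poly p).
  by rewrite (raddfB fps_of_poly) /= fps_of_poly_sw.
have eqE g : (var i - var (i + 1)) * g = p - prename (sZ i) p <->
    fps_of_poly g = dd i (fps_of_poly p).
  split=> [/(congr1 fps_of_poly)|gE]; first by rewrite e1 e2 => /dd_uniq.
  by apply: fps_of_poly_inj; rewrite e1 e2 gE; exact: dd_eq.
have [q qE] := dd_poly i p.
apply/eqE; apply: (@xgetPex _ 0 [set g | (var i - var (i + 1)) * g = p - prename (sZ i) p]).
by exists q => /=; apply/eqE.
Qed.

Lemma divdiff_comm (i j : int) p : i + 1 < j -> divdiff i (divdiff j p) = divdiff j (divdiff i p).
Proof.
have E2 a b : fps_of_poly (divdiff a (divdiff b p)) = dd a (dd b (fps_of_poly p)).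
  by rewrite (fps_divdiff a) (fps_divdiff b).
by move=> ij; apply: fps_of_poly_inj; rewrite [LHS]E2 [RHS]E2 dd_comm.
Qed.

Lemma divdiff_braid (i : int) p :
  divdiff i (divdiff (i + 1) (divdiff i p)) = divdiff (i + 1) (divdiff i (divdiff (i + 1) p)).
Proof.
have E3 a b c : fps_of_poly (divdiff a (divdiff b (divdiff c p))) =
      dd a (dd b (dd c (fps_of_poly p))).
  by rewrite (fps_divdiff a) (fps_divdiff b) (fps_divdiff c).
by apply: fps_of_poly_inj; rewrite [LHS]E3 [RHS]E3 dd_braid.
Qed.

(** * Existence of the Schubert polynomials *)

Lemma S_finP n (w : permZ) : S_fin n w -> forall i : int, 1 <= i <= n%:Z -> 1 <= w i <= n%:Z.
Proof.
move=> wn i; apply: contraLR => wi; have := wn _ wi => /permZ_inj wii.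
by rewrite -wii.
Qed.

Lemma S_finM n (v w : permZ) : S_fin n v -> S_fin n w -> S_fin n (v * w)%g.
Proof. by move=> vn wn i ni; rewrite permZ_mulE wn // vn. Qed.

Lemma S_fin_sZ n (i : int) : 1 <= i < n%:Z -> S_fin n (sZ i).
Proof. by move=> ni j nj; rewrite sZE; case_ifs; lia. Qed.

Lemma S_fin_desc n (w : permZ) i : S_fin n w -> desc w i -> 1 <= i < n%:Z.
Proof.
move=> wn di; apply/andP; split.
  by apply: desc_min di => j j1; apply: wn; lia.
by apply: desc_max di => j j1; apply: wn; lia.
Qed.

Lemma S_fin_le n m (w : permZ) : (n <= m)%N -> S_fin n w -> S_fin m w.
Proof. by move=> nm wn i im; apply: wn; lia. Qed.

Definition rev_fun (n : nat) (i : int) : int := if 1 <= i <= n%:Z then n.+1%:Z - i else i.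

Lemma rev_funK n : involutive (rev_fun n).
Proof. by move=> i; rewrite /rev_fun; case ni: (1 <= i <= n%:Z); rewrite ?ni // ifT; lia. Qed.

Definition w0 (n : nat) : permZ.
Proof.
refine (PermZ (inv_bij (@rev_funK n)) _).
apply: (sub_finite_set _ (finite_image (fun k : nat => k%:Z) (finite_II n.+1))) => i /=.
rewrite /rev_fun; case: ifP => // ni _; exists (absz i) => /=; lia.
Defined.

Lemma w0E n i : w0 n i = rev_fun n i. Proof. by []. Qed.

Lemma w0_fin n : S_fin n (w0 n).
Proof. by move=> i /negPf ni; rewrite w0E /rev_fun ni. Qed.

Lemma w0K n (w : permZ) : (w0 n * (w0 n * w))%g = w.
Proof. by apply: permZ_ext => i; rewrite !permZ_mulE !w0E rev_funK. Qed.

Lemma desc_w0 n (w : permZ) i : S_fin n w -> 1 <= i < n%:Z -> desc (w0 n * w)%g i = ~~ desc w i.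
Proof.
move=> wn ni; rewrite /desc !permZ_mulE !w0E /rev_fun !(S_finP wn); try lia.
rewrite -permZ_ltNge; lia.
Qed.

Definition dm (n : nat) : monom := \big[mmul/mone]_(1 <= i < n) expcmn (ucm i%:Z) (n - i).

Lemma dmE n (j : int) : dm n j = if 1 <= j <= n%:Z then (n - absz j)%N else 0%N.
Proof.
rewrite cm_prodE; under eq_bigr => i _ do rewrite expcmnE cmU mulnbr.
rewrite -big_mkcond; case: j => [p|p]; last by rewrite big_pred0.
rewrite (eq_bigl (fun i => i == p)) // big_nat1_eq /=.
have [pn|] := boolP (1 <= p < n)%N; case: ifP => //; try lia.
Qed.

Lemma var_exp i k : var i ^+ k = << expcmn (ucm i) k >>.
Proof.
rewrite /expcmn; case: k => [//|k]; rewrite iteropS; elim: k => [|k IHk] /=.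
  by rewrite expr1.
by rewrite exprS IHk; exact: (esym (monalgUM (ucm i) _)).
Qed.

Lemma prod_var_dm n : \prod_(1 <= i < n) var i%:Z ^+ (n - i) = << dm n >> :> polyZ.
Proof.
rewrite (eq_bigr _ (fun i _ => var_exp i%:Z (n - i)%N)).
by symmetry; apply: (big_morph (fun m : monom => << m >> : polyZ)) => // a b; exact: monalgUM.
Qed.

(** The usual formula that applies the divided difference of w^-1 w0 to the staircase monomial.
    [eval] lets the first letter of a reduced word act first, hence the inverse permutation w0 w. *)
Definition schub_fin (n : nat) (w : permZ) : polyZ :=
  eval divdiff << dm n >> (w0 n * w)%g.

Lemma schub_fin_asc n (w : permZ) (i : int) : S_fin n w -> 1 <= i < n%:Z -> ~~ desc w i ->
  schub_fin n w = divdiff i (schub_fin n (w * sZ i)%g).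
Proof.
move=> wn ni asc; rewrite /schub_fin mulgA.
apply: eval_desc; [exact: divdiff_comm|exact: divdiff_braid|].
by rewrite desc_w0.
Qed.

Lemma all_desc_w0 n (w : permZ) : S_fin n w -> (forall i : int, 1 <= i < n%:Z -> desc w i) ->
  w = w0 n.
Proof.
move=> wn dw; suff w1 : (w0 n * w)%g = 1%g by rewrite -(w0K n w) w1 mulg1.
apply: no_desc => i; apply/negP => di.
have ni : 1 <= i < n%:Z := S_fin_desc (S_finM (@w0_fin n) wn) di.
by move: di; rewrite desc_w0 // dw.
Qed.

Lemma schub_fin_w0 n : schub_fin n (w0 n) = << dm n >>.
Proof. by rewrite /schub_fin -[X in (_ * X)%g]mulg1 w0K eval1. Qed.

Lemma S_fin_ind n (P : permZ -> Prop) : P (w0 n) ->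
  (forall w i, S_fin n w -> 1 <= i < n%:Z -> ~~ desc w i -> P (w * sZ i)%g -> P w) ->
  forall w, S_fin n w -> P w.
Proof.
move=> P0 PS w wn; rewrite -(w0K n w).
have: S_fin n (w0 n * w)%g by apply: S_finM wn; exact: w0_fin.
elim/permZ_ind: (w0 n * w)%g => [|v i di IHv] vn; first by rewrite mulg1.
have ni := S_fin_desc vn di; have wn' := S_finM (@w0_fin n) vn.
apply: (PS _ i) => //; first by rewrite desc_w0 // di.
by rewrite -mulgA; apply: IHv; apply: S_finM vn _; exact: S_fin_sZ.
Qed.

(** The cycle 1, 2, ..., k + 1, with reduced word s_1 ... s_k. *)
Definition cyc_fun (k : nat) (i : int) : int :=
  if 1 <= i <= k%:Z then i + 1 else if i == k.+1%:Z then 1 else i.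

Variant cyc_spec (k : nat) (i : int) : int -> Prop :=
| CycIn of 1 <= i <= k%:Z : cyc_spec k i (i + 1)
| CycTop of i = k.+1%:Z : cyc_spec k i 1
| CycOut of (i < 1) || (k.+1%:Z < i) : cyc_spec k i i.

Lemma cycP k i : cyc_spec k i (cyc_fun k i).
Proof.
rewrite /cyc_fun; case: ifP => ik; first exact: CycIn.
by case: eqP => ik1; [apply: CycTop|apply: CycOut; lia].
Qed.

Lemma cyc_bij k : bijective (cyc_fun k).
Proof.
pose g (i : int) : int := if 2 <= i <= k.+1%:Z then i - 1 else if i == 1 then k.+1%:Z else i.
have gP i : (2 <= i <= k.+1%:Z /\ g i = i - 1) \/ (i = 1 /\ g i = k.+1%:Z) \/
    ((i < 1) || (k.+1%:Z < i) /\ g i = i).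
  by rewrite /g; case: ifP => ?; [|case: eqP => ?]; lia.
exists g => i; first by have := gP (cyc_fun k i); case: cycP => ?; lia.
by have := gP i; case: (cycP k (g i)) => ?; lia.
Qed.

Definition cyc (k : nat) : permZ.
Proof.
refine (PermZ (cyc_bij k) _).
apply: (sub_finite_set _ (finite_image (fun k : nat => k%:Z) (finite_II k.+2))) => i /=.
rewrite /cyc_fun; case: ifP => [ik _|_]; first by exists (absz i) => /=; lia.
by case: eqP => // -> _; exists k.+1 => /=.
Defined.

Lemma cycE k i : cyc k i = cyc_fun k i. Proof. by []. Qed.

Lemma cyc0 : cyc 0 = 1%g.
Proof. by apply: permZ_ext => i; rewrite cycE permZ_1E; case: cycP => ?; lia. Qed.

Lemma desc_cyc k : desc (cyc k.+1) k.+1%:Z.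
Proof. by rewrite /desc !cycE; case: cycP => ?; case: cycP => ?; lia. Qed.

Lemma cycS k : (cyc k.+1 * sZ k.+1%:Z)%g = cyc k.
Proof.
apply: permZ_ext => i; rewrite permZ_mulE !cycE sZE.
by case: (cycP k i) => ?; case_ifs; case: cycP => ?; lia.
Qed.

Lemma w0_cyc n : (w0 n.+1 * w0 n)%g = cyc n.
Proof.
apply: permZ_ext => i; rewrite permZ_mulE !w0E cycE.
case: cycP => ?; rewrite {2}/rev_fun.
- by rewrite ifT ?/rev_fun ?ifT; lia.
- by rewrite ifF ?/rev_fun ?ifT; lia.
by rewrite ifF ?/rev_fun ?ifF; lia.
Qed.

(* Stability of the Schubert polynomials comes down to [w0 n.+1 * w0 n] being a cycle:
   [d_n ... d_1] lowers the exponents of [x_1, ..., x_n] in [x^(dm n.+1)] one by one, which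
   ends in [x^(dm n)]. *)
Lemma eval_cyc n k : (k <= n)%N -> exists m : monom,
  eval divdiff << dm n.+1 >> (cyc k) = << m >> /\
  forall j : int, m j = if 1 <= j <= n%:Z then (n.+1 - absz j - (absz j <= k))%N else 0%N.
Proof.
elim: k => [_|k IHk kn].
  exists (dm n.+1); rewrite cyc0 eval1; split=> // j; rewrite dmE.
  by repeat (case: ifP => ?); lia.
have [m [em mE]] := IHk (ltnW kn).
have E := eval_desc divdiff_comm divdiff_braid << dm n.+1 >> (desc_cyc k).
rewrite cycS in E; have {}E := etrans E (congr1 (divdiff k.+1%:Z) em).
pose m' := divcm m (ucm k.+1%:Z); exists m'.
have m'E (j : int) : m' j = if 1 <= j <= n%:Z then (n.+1 - absz j - (absz j <= k.+1))%N else 0%N.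
  rewrite divcmE cmU mE; case: (eqVneq k.+1%:Z j) => [<-|jk].
    by repeat (case: ifP => ?); lia.
  by repeat (case: ifP => ?); lia.
split; last exact: m'E.
apply: (etrans E); apply: fps_of_poly_inj; rewrite fps_divdiff {E}.
(* The exponents of x_(k + 1) and x_(k + 2) in m are n - k and n - k - 1. So m' is fixed by their
   swap, and d_(k + 1) sends m = x_(k + 1) m' to m'. *)
have mm' : m = mmul (ucm k.+1%:Z) m' by rewrite mdivK // mE; case: ifP; lia.
apply: etrans (congr1 (fun q => dd k.+1%:Z (fps_of_poly << q >>)) mm') _.
apply: etrans (congr1 (dd k.+1%:Z) (fps_monomS k.+1%:Z m')) _.
have k1 : (k.+1%:Z == k.+1%:Z + 1) = false by apply/eqP; lia.
rewrite mulrC ddMl; first by rewrite ddX eqxx k1 subr0 scale1r mulr1.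
apply: sw_monom; apply: monomP => j; rewrite mswE !m'E sZE.
by case_ifs; repeat (case: ifP => ?); lia.
Qed.

Lemma schub_fin_stable n (w : permZ) : S_fin n w -> schub_fin n.+1 w = schub_fin n w.
Proof.
elim/S_fin_ind: w / => [|w i wn ni asc IH].
  rewrite schub_fin_w0 /schub_fin w0_cyc.
  have [m [-> mE]] := eval_cyc (leqnn n); congr << _ >>; apply: monomP => j.
  by rewrite mE dmE; repeat (case: ifP => ?); lia.
rewrite [RHS](schub_fin_asc wn ni asc) -IH; apply: schub_fin_asc => //; last lia.
exact: S_fin_le wn.
Qed.

Lemma schub_fin_le n k (w : permZ) : S_fin n w -> (n <= k)%N -> schub_fin k w = schub_fin n w.
Proof.
move=> wn /subnKC <-; elim: (k - n)%N => [|j IHj]; first by rewrite addn0.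
by rewrite addnS schub_fin_stable //; apply: S_fin_le wn; exact: leq_addr.
Qed.

Lemma schub_fin_eq n k (w : permZ) : S_fin n w -> S_fin k w -> schub_fin k w = schub_fin n w.
Proof.
move=> wn wk; have [nk|/ltnW kn] := leqP n k; first exact: schub_fin_le.
by rewrite (schub_fin_le wk kn).
Qed.

Lemma S_infty_fin (w : permZ) : S_infty w -> exists n, S_fin n w.
Proof.
move=> w0; have [N wN] := permZ_bound w; exists N => i iN.
have [i0|i0] := leP i 0; first exact: w0.
by apply: wN; lia.
Qed.

Lemma S_fin_infty n (w : permZ) : S_fin n w -> S_infty w.
Proof. by move=> wn i i0; apply: wn; lia. Qed.

Lemma longestE n (w : permZ) : longest n w -> w = w0 n.
Proof.
move=> [wn wmax]; apply: all_desc_w0 => // i ni.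
apply: contraT => asc; have := wmax (w * sZ i)%g (S_finM wn (S_fin_sZ ni)).
by rewrite !coxlenE ninv_asc // ltnn.
Qed.

Lemma longest_w0 n : longest n (w0 n).
Proof.
split=> [|v vn]; first exact: w0_fin.
rewrite !coxlenE; elim/S_fin_ind: v / vn => [//|v i vn ni asc IH].
by apply: ltnW; rewrite -(ninv_asc asc).
Qed.

(** [schubert] is chosen among the families with the defining properties, so nothing is known about
    it before one is constructed. By [schub_fin_eq] the choice of n is immaterial. *)
Lemma schubert_family_exists : exists S, schubert_family S.
Proof.
exists (fun w => schub_fin (xget 0%N [set n | S_fin n w]) w).
have E n w : S_fin n w -> schub_fin (xget 0%N [set n | S_fin n w]) w = schub_fin n w.
  move=> wn; apply: schub_fin_eq => //.
  by apply: (@xgetPex _ 0%N [set n | S_fin n w]); exists n.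
split=> [n w wl|w i wi i1].
  by rewrite (longestE wl) (E n) ?schub_fin_w0 ?prod_var_dm //; exact: w0_fin.
rewrite coxlen_lt => di; have [n wn] := S_infty_fin wi.
have ni := S_fin_desc wn di.
have wsn : S_fin n (w * sZ i)%g := S_finM wn (S_fin_sZ ni).
have asc : ~~ desc (w * sZ i)%g i by rewrite desc_mulN negbK.
apply: etrans (congr1 (divdiff i) (E n w wn)) _; apply: etrans _ (esym (E n _ wsn)).
apply: esym; apply: etrans (schub_fin_asc wsn ni asc) _.
exact: (congr1 (fun v => divdiff i (schub_fin n v)) (sZ_mulK w i)).
Qed.

Lemma schubertP : schubert_family schubert.
Proof. exact: xgetPex schubert_family_exists. Qed.

(** * Properties of the Schubert polynomials *)

HB.lock Definition sch (w : permZ) : fps := fps_of_poly (schubert w).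

Lemma dd_sch (w : permZ) (i : int) : S_infty w -> 1 <= i ->
  dd i (sch w) = if desc w i then sch (w * sZ i)%g else 0.
Proof.
have H v : S_infty v -> 1 <= i -> desc v i -> dd i (sch v) = sch (v * sZ i)%g.
  move=> vi i1 di; rewrite sch.unlock -fps_divdiff; congr fps_of_poly.
  by apply: (proj2 schubertP) => //; rewrite coxlen_lt.
move=> wi i1; case: ifPn => [|asc]; first exact: H.
(* At an ascent i of w, [sch w] is d_i of [sch (w * sZ i)], and d_i squares to 0. *)
rewrite -[w in LHS](sZ_mulK w i) -H ?dd_dd ?desc_mulN //.
by move=> j j0; rewrite permZ_mulE sZ_id ?wi //; apply/eqP; lia.
Qed.

Lemma sch_w0 n : sch (w0 n) = fps_of_poly << dm n >>.
Proof. by rewrite sch.unlock (proj1 schubertP n _ (@longest_w0 n)) prod_var_dm. Qed.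

Lemma w0_0 : w0 0 = 1%g.
Proof. by apply: permZ_ext => i; rewrite w0E /rev_fun ifF //; lia. Qed.

Lemma sch1 : sch 1%g = 1.
Proof.
rewrite -w0_0 sch_w0; have -> : dm 0 = mone by rewrite /dm big_geq.
exact: (rmorph1 fps_of_poly).
Qed.

Lemma sch_vars n (w : permZ) : S_fin n w -> forall (m : monom) (j : int),
  sch w m != 0 -> m j != 0%N -> 1 <= j <= n%:Z.
Proof.
elim/S_fin_ind: w / => [|w i wn ni asc IH] m j.
  rewrite sch_w0 fps_of_polyUE pnatr_eq0 eqb0 negbK => /eqP <-.
  by rewrite dmE; case: ifP.
have wsn := S_finM wn (S_fin_sZ ni).
have -> : sch w = dd i (sch (w * sZ i)%g).
  rewrite dd_sch ?desc_mulN ?asc ?sZ_mulK //; last lia.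
  exact: S_fin_infty wsn.
move=> /dd_supp[m' [m'0 _ m'm]] mj.
have [->|ji] := eqVneq j i; first lia.
have [->|ji1] := eqVneq j (i + 1); first lia.
by apply: IH m'0 _; rewrite m'm.
Qed.

Lemma homog_sch (w : permZ) : S_infty w -> homog (ninv w) (sch w).
Proof.
move=> /S_infty_fin[n wn].
have H v : S_fin n v -> forall m : monom, sch v m != 0 ->
    (mdeg m + ninv (w0 n) = mdeg (dm n) + ninv v)%N.
  elim/S_fin_ind: v / => [|v i vn ni asc IH] m.
    by rewrite sch_w0 fps_of_polyUE pnatr_eq0 eqb0 negbK => /eqP <-.
  have -> : sch v = dd i (sch (v * sZ i)%g).
    rewrite dd_sch ?desc_mulN ?asc ?sZ_mulK //; last lia.
    exact: S_fin_infty (S_finM vn (S_fin_sZ ni)).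
  move=> /dd_supp[m' [/IH + dm' _]]; rewrite dm' (ninv_asc asc) addSn addnS.
  by move=> [].
(* The identity, whose Schubert polynomial is 1, shows that the degree of the staircase monomial is
   the length of w0, without counting either. *)
have /H/(_ mone) : S_fin n 1%g by [].
rewrite sch1 fps1E eqxx oner_eq0 ninv1 mdeg1 addn0 add0n => /(_ isT) E.
by move=> m /(H _ wn); rewrite E addnC => /addnI.
Qed.

(** * Back stable Schubert polynomials *)

Lemma iter_gammaE k (w : permZ) i : iter k gammaZ w i = w (i - k%:Z) + k%:Z.
Proof.
elim: k i => [|k IHk] i; first by rewrite subr0 addr0.
rewrite iterS -[LHS]/(iter k gammaZ w (i - 1) + 1) IHk -addrA.
have -> : i - 1 - k%:Z = i - k.+1%:Z by lia.
by congr (_ + _); lia.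
Qed.

Lemma iter_gammaM k (w : permZ) i :
  iter k gammaZ (w * sZ i)%g = (iter k gammaZ w * sZ (i + k%:Z))%g.
Proof.
apply: permZ_ext => j; rewrite permZ_mulE !iter_gammaE permZ_mulE.
congr (w _ + _); rewrite !sZE; case_ifs; lia.
Qed.

Lemma iter_gamma1 k : iter k gammaZ 1%g = 1%g.
Proof. by apply: permZ_ext => j; rewrite iter_gammaE !permZ_1E subrK. Qed.

Lemma desc_gamma k (w : permZ) i : desc (iter k gammaZ w) (i + k%:Z) = desc w i.
Proof.
rewrite /desc !iter_gammaE; have -> : i + k%:Z + 1 - k%:Z = i + 1 by lia.
by rewrite addrK ltrD2r.
Qed.

Lemma ninv_gamma k (w : permZ) : ninv (iter k gammaZ w) = ninv w.
Proof.
elim/permZ_ind: w => [|w i di IH]; first by rewrite iter_gamma1.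
by rewrite (ninv_desc di) -IH iter_gammaM -ninv_desc // desc_gamma.
Qed.

Lemma sw_ren (i : int) k F :
  sw i (ren (fun j => j + k%:Z) F) = ren (fun j => j + k%:Z) (sw (i + k%:Z) F).
Proof.
have K1 : cancel (fun j => j + k%:Z) (fun j => j - k%:Z) by move=> j; rewrite addrK.
have K2 : cancel (fun j => j - k%:Z) (fun j => j + k%:Z) by move=> j; rewrite subrK.
apply/fpsP => m; rewrite swE /ren swE; apply: (congr1 F); apply: monomP => j.
rewrite (mrenameE _ _ K1 K2) !mswE (mrenameE _ _ K1 K2); apply: (congr1 m).
by rewrite !sZE; case_ifs; lia.
Qed.

Lemma dd_ren (i : int) k F :
  dd i (ren (fun j => j + k%:Z) F) = ren (fun j => j + k%:Z) (dd (i + k%:Z) F).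
Proof.
have K1 : cancel (fun j => j + k%:Z) (fun j => j - k%:Z) by move=> j; rewrite addrK.
have K2 : cancel (fun j => j - k%:Z) (fun j => j + k%:Z) by move=> j; rewrite subrK.
apply: dd_uniq; have := congr1 (ren (fun j => j + k%:Z)) (dd_eq (i + k%:Z) F).
rewrite (renM _ _ K1 K2) !renB !(renX _ K1 K2) addrK sw_ren.
by have -> : i + k%:Z + 1 - k%:Z = i + 1 by lia.
Qed.

(** The approximations gamma^(-k) S_(gamma^k w): [ren] along i + k substitutes x_(i - k) for x_i. *)
HB.lock Definition bsch (k : nat) (w : permZ) : fps :=
  ren (fun i => i + k%:Z) (sch (iter k gammaZ w)).

(** The condition that gamma^k w lies in S_infty; the approximation [bsch k w] then involves only
    x_i with i >= 1 - k. *)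
Definition fixes_le (k : nat) (w : permZ) := forall i : int, i <= - k%:Z -> w i = i.

Lemma fixes_leS k l w : (k <= l)%N -> fixes_le k w -> fixes_le l w.
Proof. by move=> kl wk i il; apply: wk; lia. Qed.

Lemma fixes_le_infty k w : fixes_le k w -> S_infty (iter k gammaZ w).
Proof. by move=> wk i i0; rewrite iter_gammaE wk ?subrK //; lia. Qed.

Lemma fixes_le_sZ k w (i : int) : - k%:Z < i -> fixes_le k w -> fixes_le k (w * sZ i)%g.
Proof.
by move=> ki wk j jk; rewrite permZ_mulE sZ_id ?wk //; apply/eqP; lia.
Qed.

Lemma bschE k w m : bsch k w m = sch (iter k gammaZ w) (mrename (fun i => i + k%:Z) m).
Proof. by rewrite bsch.unlock. Qed.

Lemma bsch1 k : bsch k 1%g = 1.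
Proof.
rewrite bsch.unlock iter_gamma1 sch1; apply: (@ren1 _ (fun j => j - k%:Z)) => j.
  by rewrite addrK.
by rewrite subrK.
Qed.

Lemma dd_bsch k w (i : int) : fixes_le k w -> - k%:Z < i ->
  dd i (bsch k w) = if desc w i then bsch k (w * sZ i)%g else 0.
Proof.
move=> wk ki; rewrite bsch.unlock dd_ren dd_sch; [|exact: fixes_le_infty|lia].
by rewrite desc_gamma iter_gammaM; case: ifP.
Qed.

Lemma homog_bsch k w : fixes_le k w -> homog (ninv w) (bsch k w).
Proof.
move=> wk m; rewrite bschE => /(homog_sch (fixes_le_infty wk)).
by rewrite mdeg_mrename ninv_gamma.
Qed.

Lemma bsch_vars k (w : permZ) (N : int) : fixes_le k w -> (forall i : int, N < i -> w i = i) ->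
  - k%:Z <= N -> vars_le N (bsch k w).
Proof.
move=> wk wN kN m j; rewrite bschE => Pm Nj; apply/eqP; apply: contrapT => /negP mj.
have K1 : cancel (fun j => j + k%:Z) (fun j => j - k%:Z) by move=> i; rewrite addrK.
have K2 : cancel (fun j => j - k%:Z) (fun j => j + k%:Z) by move=> i; rewrite subrK.
have wf : S_fin (absz (N + k%:Z)) (iter k gammaZ w).
  move=> i iN; rewrite iter_gammaE.
  have [i0|i0] := leP i 0; first by rewrite wk ?subrK //; lia.
  by rewrite wN ?subrK //; lia.
have := sch_vars wf Pm (j := j + k%:Z); rewrite (mrenameE _ _ K1 K2) addrK => /(_ mj).
by lia.
Qed.

(** * Truncation to large indices and the limit *)

(** The substitution x_i = 0 for i < a. It respects products and commutes with d_i for i >= a. *)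
Definition above (a : int) (F : fps) : fps := fun m =>
  if `[< forall i : int, m i != 0%N -> a <= i >] then F m else 0.

Lemma aboveE (a : int) F (m : monom) : (forall i : int, m i != 0%N -> a <= i) -> above a F m = F m.
Proof. by move=> am; rewrite /above asboolT. Qed.

Lemma above_out (a : int) F (m : monom) :
  ~ (forall i : int, m i != 0%N -> a <= i) -> above a F m = 0.
Proof. by move=> am; rewrite /above asboolF. Qed.

Lemma aboveB (a : int) F G : above a (F - G) = above a F - above a G.
Proof. by apply/fpsP => m; rewrite fpsBE /above; case: asboolP => _; rewrite ?subr0. Qed.

Lemma aboveX (a i : int) F : a <= i -> X i * above a F = above a (X i * F).
Proof.
move=> ai; apply/fpsP => m; rewrite X_mulE.
have [am|am] := pselect (forall j : int, m j != 0%N -> a <= j).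
  rewrite [RHS]aboveE // X_mulE; case: eqP => // mi; rewrite aboveE // => j.
  by rewrite divcmE => mj; apply: am; apply: contraNneq mj => ->.
rewrite [RHS]above_out //; case: eqP => // /eqP mi; rewrite above_out // => am'; apply: am => j mj.
have [->//|ji] := eqVneq j i.
by apply: am'; rewrite divcmE cmU [i == j]eq_sym (negPf ji) subn0.
Qed.

Lemma sw_above (a i : int) F : a <= i -> sw i (above a F) = above a (sw i F).
Proof.
move=> ai; apply/fpsP => m; rewrite swE.
have E (m' : monom) : (forall j : int, m' j != 0%N -> a <= j) ->
      forall j : int, msw i m' j != 0%N -> a <= j.
  by move=> am j; rewrite mswE => /am; rewrite sZE; case_ifs; lia.
have [am|am] := pselect (forall j : int, m j != 0%N -> a <= j).
  by rewrite !aboveE ?swE //; apply: E.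
by rewrite !above_out // => /E; rewrite mswK.
Qed.

Lemma dd_above (a i : int) F : a <= i -> dd i (above a F) = above a (dd i F).
Proof.
move=> ai; apply: dd_uniq; rewrite mulrBl !aboveX; try lia.
by rewrite -aboveB -mulrBl dd_eq sw_above // aboveB.
Qed.

Lemma permZ_le_fix (w : permZ) :
  exists N : nat, fixes_le N w /\ forall i : int, N%:Z < i -> w i = i.
Proof.
by have [N wN] := permZ_bound w; exists N.+1; split=> i iN; apply: wN; lia.
Qed.

(** By induction on the inversions, the difference Q of the two sides is killed by d_i for all i >=
    1 - k. It is thus symmetric in every variable that it may contain, so it is constant by
    [sym_vars_lt]; the constant terms are both 1 for w = 1 and vanish by homogeneity otherwise. *)
Lemma bsch_above k w : fixes_le k w ->
  above (1 - k%:Z) (bsch k.+1 w) = above (1 - k%:Z) (bsch k w).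
Proof.
have [n le_n] := ubnP (ninv w); elim: n w le_n => [//|n IHn] w le_n wk.
have wk1 : fixes_le k.+1 w by apply: fixes_leS wk.
apply/eqP; rewrite -subr_eq0 -aboveB; apply/eqP.
set Q := above _ _.
have Qsw (i : int) : 1 - k%:Z <= i -> sw i Q = Q.
  move=> ki; apply: dd_eq0; rewrite /Q dd_above // ddB !dd_bsch //; try lia.
  case: ifPn => di; last by rewrite subrr -[X in above _ X](subrr 0) aboveB subrr.
  rewrite aboveB IHn ?subrr //; first by move: le_n; rewrite (ninv_desc di).
  by apply: fixes_le_sZ wk; lia.
have [N [_ wN]] := permZ_le_fix w.
have QN : vars_le N%:Z Q.
  move=> m i; rewrite /Q; have [am|am] := pselect (forall i : int, m i != 0%N -> 1 - k%:Z <= i).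
    rewrite aboveE // => /fpsD_neq0[|/fpsN_neq0] Pm Ni; apply: bsch_vars Pm Ni => //; lia.
  by rewrite above_out // eqxx.
apply/fpsP => m; change (Q m = 0); apply/eqP; apply: contrapT => /negP Qm.
have am : forall i : int, m i != 0%N -> 1 - k%:Z <= i.
  have [//|am] := pselect (forall i : int, m i != 0%N -> 1 - k%:Z <= i).
  by case/negP: Qm; rewrite /Q above_out.
have m1 : m = mone.
  apply: monomP => i; rewrite cm1; apply/eqP; apply: contrapT => /negP mi.
  by case/negP: (mi); rewrite (sym_vars_lt QN Qsw Qm) //; exact: am.
move: Qm; rewrite m1 /Q aboveE; last by move=> i; rewrite cm1.
have [->|w1] := eqVneq w 1%g; first by rewrite !bsch1 fpsBE subrr eqxx.
have ninv0 : ninv w != 0%N.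
  by move/eqP: w1 => /exists_desc[i /ninv_desc ->].
have H0 l : fixes_le l w -> bsch l w mone = 0.
  move=> wl; apply/eqP; apply: contrapT => /negP /(homog_bsch wl).
  by rewrite mdeg1 => E; rewrite -E in ninv0.
by rewrite fpsBE !H0 // subrr eqxx.
Qed.

Lemma bsch_stable k l w (m : monom) : fixes_le k w -> (k <= l)%N ->
  (forall i : int, m i != 0%N -> 1 - k%:Z <= i) -> bsch l w m = bsch k w m.
Proof.
move=> wk /subnKC <- mk; elim: (l - k)%N => [|j IHj]; first by rewrite addn0.
rewrite addnS -IHj.
have mkj (i : int) : m i != 0%N -> 1 - (k + j)%N%:Z <= i by move=> /mk; lia.
rewrite -(aboveE (bsch (k + j).+1 w) mkj) bsch_above ?aboveE //.
by apply: fixes_leS wk; lia.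
Qed.

HB.lock Definition bss (w : permZ) : fps := back_stable_schubert w.

Lemma monom_bound (m : monom) : exists k : nat, forall i : int, m i != 0%N -> 1 - k%:Z <= i.
Proof.
exists (\sum_(i <- finsupp m) absz i).+1 => i; rewrite cmE_neq0 => im.
rewrite (big_fsetD1 i) //=; lia.
Qed.

Lemma bssE k w (m : monom) : fixes_le k w -> (forall i : int, m i != 0%N -> 1 - k%:Z <= i) ->
  bss w m = bsch k w m.
Proof.
move=> wk mk; rewrite bss.unlock /back_stable_schubert; set A := [set c | _].
have E l : (prename (fun i => i - l%:Z) (schubert (iter l gammaZ w)))@_m = bsch l w m.
  rewrite bsch.unlock sch.unlock -(@fps_of_poly_prename (fun i => i - l%:Z)) //.
    by move=> i; rewrite subrK.
  by move=> i; rewrite addrK.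
have Ak : A (bsch k w m) by exists k => l kl; rewrite E; apply: bsch_stable.
have [N HN] := @xgetPex _ 0 A (ex_intro _ _ Ak).
(* Whatever value [xget] returns is attained at all large indices, among them one beyond k. *)
rewrite -(HN (maxn N k)) ?leq_maxl // E; apply: bsch_stable => //; exact: leq_maxr.
Qed.

Lemma bss_above k w : fixes_le k w -> above (1 - k%:Z) (bss w) = above (1 - k%:Z) (bsch k w).
Proof.
move=> wk; apply/fpsP => m.
have [am|am] := pselect (forall i : int, m i != 0%N -> 1 - k%:Z <= i).
  by rewrite !aboveE //; apply: bssE.
by rewrite !above_out.
Qed.

Lemma bss1 : bss 1%g = 1.
Proof.
apply/fpsP => m; have [k mk] := monom_bound m.
by rewrite (@bssE k) // bsch1.
Qed.

Lemma permZ_monom_bound (w : permZ) (m : monom) :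
  exists k, fixes_le k w /\ forall i : int, m i != 0%N -> 1 - k%:Z <= i.
Proof.
have [k mk] := monom_bound m; have [N [wN _]] := permZ_le_fix w.
exists (maxn k N); split; first by apply: fixes_leS wN; exact: leq_maxr.
by move=> i /mk; lia.
Qed.

Lemma homog_bss w : homog (ninv w) (bss w).
Proof.
move=> m; have [k [wk mk]] := permZ_monom_bound w m.
by rewrite (bssE wk mk); apply: homog_bsch.
Qed.

Lemma bss_vars (w : permZ) (N : int) : (forall i : int, N < i -> w i = i) -> vars_le N (bss w).
Proof.
move=> wN m i; have [k [wk mk]] := permZ_monom_bound w m.
pose l := maxn k (absz N); have wl : fixes_le l w by apply: fixes_leS wk; exact: leq_maxl.
rewrite (bssE wl) => [Pm Ni|j /mk]; last by lia.
by apply: (bsch_vars wl wN) Pm Ni; lia.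
Qed.

Lemma dd_bss w (i : int) : dd i (bss w) = if desc w i then bss (w * sZ i)%g else 0.
Proof.
apply/fpsP => m; have [k [wk mk]] := permZ_monom_bound w m.
(* For this l both m and the index i survive truncation at 1 - l, so d_i may be computed on
   [bsch l w]. *)
pose l := maxn k (absz i).+1; have wl : fixes_le l w by apply: fixes_leS wk; exact: leq_maxl.
have ml (j : int) : m j != 0%N -> 1 - l%:Z <= j by move=> /mk; lia.
have il : - l%:Z < i by lia.
rewrite -(aboveE _ ml) -dd_above; last lia.
rewrite bss_above // dd_above; last lia.
rewrite dd_bsch // -[RHS](aboveE _ ml); case: ifP => // _.
by rewrite bss_above //; apply: fixes_le_sZ.
Qed.

Lemma stable_bss w : exists a b d, stable a b d (bss w).
Proof.
have [N [w_ wN]] := permZ_le_fix w; exists (1 - N%:Z), N%:Z, (ninv w); split.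
- exact/homog_deg/homog_bss.
- exact: bss_vars.
move=> i iN; apply: dd_eq0; rewrite dd_bss ifF //; apply/negP => di.
have := @desc_min w (1 - N%:Z) _ i di; rewrite leNgt iN => H.
by have : false by apply: H => j jN; apply: w_; lia.
Qed.

Definition back_stable : set fps := [set F | exists a b d, stable a b d F].

Lemma back_stableP (F G : fps) : back_stable F -> back_stable G ->
  exists a b d, stable a b d F /\ stable a b d G.
Proof.
move=> [a [b [d Fs]]] [a' [b' [d' Gs]]].
exists (Order.min a a'), (Order.max b b'), (maxn d d').
by split; [apply: stableS Fs|apply: stableS Gs]; lia.
Qed.

Lemma back_stableD F G : back_stable F -> back_stable G -> back_stable (F + G).
Proof.
move=> FR GR; have [a [b [d [Fs Gs]]]] := back_stableP FR GR.
by exists a, b, d; apply: stableD.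
Qed.

Lemma back_stableZ c F : back_stable F -> back_stable (c *: F).
Proof. by move=> [a [b [d Fs]]]; exists a, b, d; apply: stableZ. Qed.

Lemma back_stableM F G : back_stable F -> back_stable G -> back_stable (F * G).
Proof.
move=> FR GR; have [a [b [d [Fs Gs]]]] := back_stableP FR GR.
by exists a, b, (d + d)%N; apply: stableM.
Qed.

Lemma back_stable0 : back_stable 0.
Proof.
exists 0, 0, 0%N; split=> [m|m i|i _]; rewrite ?eqxx //.
by rewrite sw.unlock.
Qed.

Lemma back_stable_sum (T : Type) (s : seq T) (P : pred T) (F : T -> fps) :
  (forall i, P i -> back_stable (F i)) -> back_stable (\sum_(i <- s | P i) F i).
Proof.
by move=> FR; apply: big_ind => //; [exact: back_stable0|exact: back_stableD].
Qed.

(** * Coefficients in the basis of back stable Schubert polynomials *)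

Definition pull (i : int) (phi : fps -> rat) : fps -> rat := phi \o dd i.

(* The constant term of [dd_w F]: since [pull] precomposes, [eval] applies the divided
   differences along a reduced word of [w] from its last letter to its first. *)
HB.lock Definition cf (F : fps) (w : permZ) : rat := eval pull (fun G => G mone) w F.

Lemma cf1 F : cf F 1%g = F mone.
Proof. by rewrite cf.unlock eval1. Qed.

Lemma pull_comm (i j : int) phi : i + 1 < j -> pull i (pull j phi) = pull j (pull i phi).
Proof. by move=> ij; apply/funext => G; rewrite /pull /= (dd_comm _ ij). Qed.

Lemma pull_braid (i : int) phi :
  pull i (pull (i + 1) (pull i phi)) = pull (i + 1) (pull i (pull (i + 1) phi)).
Proof. by apply/funext => G; rewrite /pull /= dd_braid. Qed.

Lemma cf_desc F w i : desc w i -> cf F w = cf (dd i F) (w * sZ i)%g.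
Proof.
move=> di; rewrite cf.unlock.
by rewrite (eval_desc pull_comm pull_braid (fun G : fps => G mone) di).
Qed.

Lemma cfD F G w : cf (F + G) w = cf F w + cf G w.
Proof.
elim/permZ_ind: w F G => [|w i di IH] F G; first by rewrite !cf1.
by rewrite !(cf_desc _ di) ddD IH.
Qed.

Lemma cfZ c F w : cf (c *: F) w = c * cf F w.
Proof.
elim/permZ_ind: w F => [|w i di IH] F; first by rewrite !cf1.
by rewrite !(cf_desc _ di) ddZ IH.
Qed.

Lemma cf0 w : cf 0 w = 0.
Proof. by rewrite -(scale0r (0 : fps)) cfZ mul0r. Qed.

Lemma cf_sum (T : Type) (s : seq T) (P : pred T) (F : T -> fps) w :
  cf (\sum_(i <- s | P i) F i) w = \sum_(i <- s | P i) cf (F i) w.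
Proof.
by apply: (big_morph (fun F => cf F w)) => [F' G|]; [exact: cfD|exact: cf0].
Qed.

(** A descent i of w is removed from both permutations if v has it too; otherwise both sides are 0.
    At w = 1 homogeneity decides. *)
Lemma cf_bss v w : cf (bss v) w = (v == w)%:R.
Proof.
elim/permZ_ind: w v => [|w i di IH] v.
  rewrite cf1; have [->|v1] := eqVneq v 1%g; first by rewrite bss1 fps1E eqxx.
  apply/eqP; apply: contrapT => /negP /homog_bss; rewrite mdeg1 => n0.
  by move/eqP: v1 => /exists_desc[i /ninv_desc]; rewrite -n0.
rewrite (cf_desc _ di) dd_bss; case: ifPn => dv.
  rewrite IH; congr (_%:R); congr nat_of_bool; apply/eqP/eqP => [|->//].
  by rewrite -{2}(sZ_mulK v i) => ->; rewrite sZ_mulK.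
by rewrite cf0; case: eqP dv => // ->; rewrite di.
Qed.

Lemma cf_complete_aux (a b : int) d F : stable a b d F -> (forall w, cf F w = 0) ->
  (forall i, dd i F = 0) -> F = 0.
Proof.
move=> [_ bF _] cF dF; apply/fpsP => m; change (F m = 0).
apply/eqP; apply: contrapT => /negP Fm; have sF i : sw i F = F by apply: dd_eq0.
have m1 : m = mone.
  apply: monomP => i; rewrite cm1.
  by apply: (@sym_vars_lt i b F bF _ m i Fm) => // j _.
by move: Fm; rewrite m1 -cf1 cF eqxx.
Qed.

Lemma cf_complete F : back_stable F -> (forall w, cf F w = 0) -> F = 0.
Proof.
move=> [a [b [d]]]; elim: d a b F => [|d IHd] a b F Fs cF.
  apply: (cf_complete_aux Fs cF) => i; case: Fs => dF _ _; exact: dd_deg0.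
apply: (cf_complete_aux Fs cF) => i; apply: (IHd _ _ _ (stable_dd i Fs)) => v.
(* A coordinate of [dd i F] at v is 0 since d_i squares to 0 if i is a descent of v, and is the
   coordinate of F at v s_i if not. *)
case: (boolP (desc v i)) => dv; first by rewrite (cf_desc _ dv) dd_dd cf0.
have := @cf_desc F (v * sZ i)%g i; rewrite desc_mulN sZ_mulK cF => /(_ dv) //.
Qed.

(** If w has a descent i, its coordinate in F is that of w s_i in [dd i F], which has smaller
    degree. Only the i with a <= i <= b contribute, by [dd_stable0]. *)
Lemma cf_finite F : back_stable F -> exists s : seq permZ, forall w, cf F w != 0 -> w \in s.
Proof.
move=> [a [b [d]]]; elim: d a b F => [|d IHd] a b F Fs.
  exists [:: 1%g] => w; rewrite inE; apply: contraR => /eqP /exists_desc[i di].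
  by rewrite (cf_desc _ di) dd_deg0 ?cf0 //; case: Fs.
have /choice[s sP] : forall i : int, exists s : seq permZ,
    forall w, cf (dd i F) w != 0 -> w \in s.
  by move=> i; apply: IHd (stable_dd i Fs).
pose I := [seq a + k%:Z | k <- iota 0 (absz (b - a)).+1].
exists (1%g :: [seq (v * sZ i)%g | i <- I, v <- s i]) => w wF; rewrite inE.
have [//|w1] := eqVneq w 1%g; move/eqP: w1 => /exists_desc[i di]; apply/orP; right.
move: wF; rewrite (cf_desc _ di) => wF.
apply/flatten_mapP; exists i; last first.
  by apply/mapP; exists (w * sZ i)%g; rewrite ?sZ_mulK //; exact: sP.
have : ~~ ((i < a) || (b < i)).
  by apply: contraNN wF => H; rewrite (dd_stable0 Fs H) cf0.
move=> abi; apply/mapP; exists (absz (i - a)); last lia.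
by rewrite mem_iota; lia.
Qed.

Lemma bss_basis : is_basis bss back_stable.
Proof.
split=> [s c us sum0 w ws|].
  have := congr1 (fun F => cf F w) sum0; rewrite cf0 cf_sum => H; rewrite -[RHS]H.
  rewrite (bigD1_seq w) //= cfZ cf_bss eqxx mulr1 big1 ?addr0 // => v vw.
  by rewrite cfZ cf_bss (negPf vw) mulr0.
rewrite predeqE => F; split=> [[s [c ->]]|FR].
  by apply: back_stable_sum => w _; apply: back_stableZ; exact: stable_bss.
have [s sP] := cf_finite FR; exists (undup s), (cf F).
apply/eqP; rewrite -subr_eq0; apply/eqP; set G := \sum_(_ <- _) _.
have GR : back_stable G.
  by apply: back_stable_sum => w _; apply: back_stableZ; exact: stable_bss.
rewrite -[G]scale1r -scaleNr; apply: cf_complete => [|w].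
  by apply: back_stableD => //; apply: back_stableZ.
rewrite cfD cfZ cf_sum; have [ws|ws] := boolP (w \in undup s).
  rewrite (bigD1_seq w) ?undup_uniq //= cfZ cf_bss eqxx mulr1 big1 ?addr0 => [|v vw].
    by rewrite mulN1r subrr.
  by rewrite cfZ cf_bss (negPf vw) mulr0.
rewrite big1_seq => [|v /= vs]; last first.
  by rewrite cfZ cf_bss; case: eqP vs ws => [-> ->|]; rewrite ?mulr0.
rewrite mulr0 addr0; apply/eqP; apply: contrapT => /negP /sP.
by rewrite mem_undup in ws; rewrite (negPf ws).
Qed.

(** * Linear spans *)

Section Span.
Variables (V : lmodType rat) (T : eqType) (b : T -> V).

(** Weighted lists with repetitions make sums concatenations. P remembers which indices occur, as
    the straightening needs. *)
Definition span_on (P : T -> Prop) : set V := [set v | exists L : seq (rat * T),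
  v = \sum_(p <- L) p.1 *: b p.2 /\ {in L, forall p, P p.2}].

Lemma span_on_lin P v : span_on P v -> lin_span b v.
Proof.
move=> [L [-> _]]; exists (undup [seq p.2 | p <- L]), (fun t => \sum_(p <- L | p.2 == t) p.1).
under [RHS]eq_bigr => t _ do rewrite scaler_suml big_mkcond.
rewrite exchange_big /=; apply: eq_big_seq => p pL.
rewrite -big_mkcond /= (eq_bigl (pred1 p.2)) => [|t]; last by rewrite eq_sym.
rewrite -big_filter filter_pred1_uniq ?undup_uniq ?big_seq1 // mem_undup; exact: map_f.
Qed.

Lemma lin_span_on v : lin_span b v -> span_on (fun=> True) v.
Proof.
by move=> [s [c ->]]; exists [seq (c t, t) | t <- s]; rewrite big_map; split.
Qed.

Lemma span_onS (P Q : T -> Prop) v : (forall t, P t -> Q t) -> span_on P v -> span_on Q v.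
Proof. by move=> PQ [L [-> LP]]; exists L; split=> // p /LP /PQ. Qed.

Lemma span_on_base (P : T -> Prop) t : P t -> span_on P (b t).
Proof.
move=> Pt; exists [:: (1, t)]; rewrite big_seq1 scale1r; split=> // p.
by rewrite inE => /eqP ->.
Qed.

Lemma span_on0 P : span_on P 0.
Proof. by exists [::]; rewrite big_nil. Qed.

Lemma span_onD P u v : span_on P u -> span_on P v -> span_on P (u + v).
Proof.
move=> [L [-> LP]] [M [-> MP]]; exists (L ++ M); rewrite big_cat; split=> // p.
by rewrite mem_cat => /orP[/LP|/MP].
Qed.

Lemma span_onZ P c v : span_on P v -> span_on P (c *: v).
Proof.
move=> [L [-> LP]]; exists [seq (c * p.1, p.2) | p <- L].
rewrite big_map scaler_sumr; split; first by apply: eq_bigr => p _; rewrite scalerA.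
by move=> p /mapP[q /LP ? ->].
Qed.

Lemma span_onB P u v : span_on P u -> span_on P v -> span_on P (u - v).
Proof. by move=> uP vP; rewrite -scaleN1r; apply: span_onD => //; apply: span_onZ. Qed.

Lemma span_on_sum P (I : Type) (s : seq I) (Q : pred I) (F : I -> V) :
  (forall i, Q i -> span_on P (F i)) -> span_on P (\sum_(i <- s | Q i) F i).
Proof. by move=> FP; apply: big_ind => //; [exact: span_on0|exact: span_onD]. Qed.

End Span.

Lemma span_on_mul (T : eqType) (b : T -> fps) (P Q : T -> Prop) (G F : fps) :
  (forall t, P t -> span_on b Q (G * b t)) -> span_on b P F -> span_on b Q (G * F).
Proof.
move=> GQ [L [-> LP]]; rewrite mulr_sumr big_seq; apply: span_on_sum => p pL.
by rewrite -scalerAr; apply: span_onZ; apply: GQ; apply: LP.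
Qed.

(** * Straightening products of elementary symmetric functions *)

Local Notation index := {fsfun int -> nat with 0%N}.
Local Notation sem := back_stable_sem.

Lemma sem_fset (A : {fset int}) (al : index) : (finsupp al `<=` A)%fset ->
  sem al = \prod_(i <- A) elemsym i (al i).
Proof.
move=> sA; apply: (big_fset_incl _ sA) => i _ /fsfun_dflt ->; exact: elemsym0.
Qed.

Lemma sem_upd (al : index) k i : al k = 0%N -> sem [fsfun al with k |-> i] = elemsym k i * sem al.
Proof.
move=> alk; have kal : k \notin finsupp al by rewrite mem_finsupp alk.
have sA : (finsupp ([fsfun al with k |-> i]) `<=` k |` finsupp al)%fset.
  apply/fsubsetP => j; rewrite mem_finsupp fsfun_withE !inE mem_finsupp.
  by case: (eqVneq j k).
rewrite (sem_fset sA) big_fsetU1 //= fsfun_withE eqxx; congr (_ * _).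
by apply: eq_big_seq => j jal; rewrite fsfun_withE; case: eqP jal kal => // -> ->.
Qed.

Lemma sem0 : sem [fsfun] = 1.
Proof. by rewrite /back_stable_sem finsupp0 big_seq_fset0. Qed.

Definition agree (k : int) (al be : index) := forall j : int, j < k -> be j = al j.

(** The terms containing x_(k + 1) cancel. As a rewriting rule this trades the degrees (i, j + 1) at
    level k for (i + 1, j), modulo products with one factor at level k and one at k + 1. *)
Lemma elemsym_exchange (k : int) i j : elemsym k i * elemsym k j.+1 =
  elemsym k i * elemsym (k + 1) j.+1 - elemsym k j * elemsym (k + 1) i.+1 +
  elemsym k i.+1 * elemsym k j.
Proof. by rewrite !(elemsymS (k + 1)) addrK; ring. Qed.

(** A second factor at level k is pushed upwards: the inner induction lowers [al k] to 0 by
    [elemsym_exchange], and the outer one is on the number n of levels that may still be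
    occupied. *)
Lemma straighten n (al : index) (k : int) i : (forall j : int, k + n%:Z <= j -> al j = 0%N) ->
  span_on sem (agree k al) (elemsym k i * sem al).
Proof.
elim: n al k i => [|n IHn] al k i alk.
  rewrite -sem_upd; last by apply: alk; lia.
  apply: span_on_base => j jk; rewrite fsfun_withE ifF //; apply/eqP; lia.
pose be := [fsfun al with k |-> 0%N].
have bek : be k = 0%N by rewrite fsfun_withE eqxx.
have beal j : j != k -> be j = al j by move=> /negPf jk; rewrite fsfun_withE jk.
have -> : sem al = elemsym k (al k) * sem be.
  rewrite -sem_upd //; congr sem; apply/fsfunP => j; rewrite !fsfun_withE.
  by case: eqP => [->|].
(* Level k is empty in [be]. Straightening at level k + 1 leaves it empty, which is what [agree]
   records, so [elemsym k a] can be inserted there. *)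
have U a c : span_on sem (agree k al) (elemsym k a * (elemsym (k + 1) c * sem be)).
  have Hbe : forall j : int, k + 1 + n%:Z <= j -> be j = 0%N.
    by move=> j jn; rewrite beal; [apply: alk; lia|apply/eqP; lia].
  apply: span_on_mul (IHn be (k + 1) c Hbe) => ga gabe.
  rewrite -sem_upd; last by rewrite gabe ?bek //; lia.
  apply: span_on_base => j jk; rewrite fsfun_withE ifF; last by apply/eqP; lia.
  by rewrite gabe ?beal //; [apply/eqP; lia|lia].
elim: (al k) i => [|j IHj] i.
  by have := U i 0%N; rewrite !elemsym0.
rewrite mulrA elemsym_exchange mulrDl mulrBl -!mulrA.
by apply: span_onD => //; apply: span_onB.
Qed.

Lemma fsfun_bound (al : index) : exists N : nat, forall j : int, (N <= absz j)%N -> al j = 0%N.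
Proof.
exists (\sum_(i <- finsupp al) absz i).+1 => j Nj; apply: fsfun_dflt.
by apply: contraL Nj => jal; rewrite (big_fsetD1 j) //= -ltnNge ltnS leq_addr.
Qed.

Definition semspan : set fps := lin_span sem.

Lemma semspanP F : semspan F <-> span_on sem (fun=> True) F.
Proof. by split; [exact: lin_span_on|exact: span_on_lin]. Qed.

Lemma semspanD F G : semspan F -> semspan G -> semspan (F + G).
Proof. by rewrite !semspanP; exact: span_onD. Qed.

Lemma semspanZ c F : semspan F -> semspan (c *: F).
Proof. by rewrite !semspanP; exact: span_onZ. Qed.

Lemma semspanB F G : semspan F -> semspan G -> semspan (F - G).
Proof. by rewrite !semspanP; exact: span_onB. Qed.

Lemma semspan0 : semspan 0.
Proof. by rewrite semspanP; exact: span_on0. Qed.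

Lemma semspan1 : semspan 1.
Proof. by rewrite semspanP -sem0; exact: span_on_base. Qed.

Lemma semspan_sum (I : Type) (s : seq I) (Q : pred I) (F : I -> fps) :
  (forall i, Q i -> semspan (F i)) -> semspan (\sum_(i <- s | Q i) F i).
Proof. by move=> FP; apply: big_ind => //; [exact: semspan0|exact: semspanD]. Qed.

Lemma semspan_elemsym (k : int) i F : semspan F -> semspan (elemsym k i * F).
Proof.
rewrite !semspanP; apply: span_on_mul => al _; have [N HN] := fsfun_bound al.
apply: span_onS (@straighten (absz k + N) al k i _) => // j kj.
by apply: HN; lia.
Qed.

Lemma semspanX i F : semspan F -> semspan (X i * F).
Proof.
by move=> FE; rewrite X_elemsym mulrBl; apply: semspanB; apply: semspan_elemsym.
Qed.

(** * Linear independence of the standard elementary monomials *)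

(** The operator d_(k - a + 1) ... d_k, with d_k acting first. It takes e_a(k) to 1, because each d
    lowers both the degree and the level by one. *)
Fixpoint dd_run (k : int) (a : nat) (F : fps) : fps :=
  if a is a'.+1 then dd (k - a'%:Z) (dd_run k a' F) else F.

Lemma dd_run_elemsym k a d : dd_run k a (elemsym k (a + d)) = elemsym (k - a%:Z) d.
Proof.
elim: a d => [|a IHa] d /=; first by rewrite subr0.
rewrite addSnnS IHa dd_elemsym; congr elemsym; lia.
Qed.

Lemma dd_run0 k a : dd_run k a 0 = 0.
Proof. by elim: a => [//|a IHa] /=; rewrite IHa dd0. Qed.

Lemma dd_runMl k a G F : (forall i : int, i <= k -> sw i G = G) ->
  dd_run k a (G * F) = G * dd_run k a F.
Proof.
move=> sG; elim: a => [//|a IHa] /=; rewrite IHa ddMl // sG //; lia.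
Qed.

Lemma dd_run_homog k a d F : homog (a + d) F -> homog d (dd_run k a F).
Proof.
elim: a d => [//|a IHa] d /=; rewrite addSnnS => /IHa; exact: dd_homog.
Qed.

Lemma dd_run_homog0 k a d F : (d < a)%N -> homog d F -> dd_run k a F = 0.
Proof.
elim: a => [//|a IHa]; rewrite ltnS leq_eqVlt => /orP[/eqP -> hF|da hF] /=.
  by apply: dd_homog0; apply: dd_run_homog; rewrite addn0.
by rewrite IHa // dd0.
Qed.

Section Pairing.
Variable lo : int.

(* [dd_runs be n] is the product of the operators [dd_(k - be_k + 1) ... dd_k] over
   [lo <= k < lo + n], the smallest [k] acting first. *)
Fixpoint dd_runs (be : index) (n : nat) (F : fps) : fps :=
  if n is n'.+1 then dd_run (lo + n'%:Z) (be (lo + n'%:Z)) (dd_runs be n' F) else F.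

Definition psem (al : index) (n : nat) : fps :=
  \prod_(j < n) elemsym (lo + j%:Z) (al (lo + j%:Z)).

Definition wt (al : index) (n : nat) : nat := \sum_(j < n) al (lo + j%:Z)%R.

Lemma psemS al n : psem al n.+1 = elemsym (lo + n%:Z) (al (lo + n%:Z)) * psem al n.
Proof. by rewrite /psem big_ord_recr mulrC. Qed.

Lemma wtS al n : wt al n.+1 = (al (lo + n%:Z)%R + wt al n)%N.
Proof. by rewrite /wt big_ord_recr addnC. Qed.

Lemma homog_psem al n : homog (wt al n) (psem al n).
Proof.
elim: n => [|n IHn]; first by rewrite /wt /psem !big_ord0; exact: homog1.
rewrite psemS wtS; apply: homogM => //; exact: homog_elemsym.
Qed.

Lemma dd_runsMl be n G F : (forall i : int, i < lo + n%:Z -> sw i G = G) ->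
  dd_runs be n (G * F) = G * dd_runs be n F.
Proof.
elim: n => [//|n IHn] sG /=.
rewrite IHn; last by move=> i il; apply: sG; lia.
by rewrite dd_runMl // => i il; apply: sG; lia.
Qed.

Lemma dd_runs_homog be n d F : homog (wt be n + d) F -> homog d (dd_runs be n F).
Proof.
elim: n d => [|n IHn] d /=; first by rewrite /wt big_ord0.
rewrite wtS => hF; apply: dd_run_homog; apply: IHn.
by rewrite addnA [(wt _ _ + _)%N]addnC.
Qed.

Lemma dd_runs_homog0 be n d F : (d < wt be n)%N -> homog d F -> dd_runs be n F = 0.
Proof.
elim: n => [|n IHn] /=; first by rewrite /wt big_ord0.
rewrite wtS => dn hF; have [dw|wd] := ltnP d (wt be n); first by rewrite IHn // dd_run0.
apply: (@dd_run_homog0 _ _ (d - wt be n)); first lia.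
by apply: dd_runs_homog; rewrite subnKC.
Qed.

(** The operators on the left are d_i with i < lo + n, and e(lo + n) is symmetric under those s_i.
    So the top factor is a scalar for them. *)
Lemma dd_runs_psemS be al n : dd_runs be n (psem al n.+1) =
  elemsym (lo + n%:Z) (al (lo + n%:Z)) * dd_runs be n (psem al n).
Proof.
rewrite psemS dd_runsMl // => i il; apply: sw_elemsym; apply/eqP; lia.
Qed.

Lemma dd_runs_psem_diag be n : dd_runs be n (psem be n) = 1.
Proof.
elim: n => [|n IHn]; first by rewrite /psem big_ord0.
rewrite -[LHS]/(dd_run _ _ (dd_runs be n (psem be n.+1))) dd_runs_psemS IHn mulr1.
by rewrite -[in elemsym _ _](addn0 (be _)) dd_run_elemsym elemsym0.
Qed.

Definition agree_below (n : nat) (al be : index) :=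
  forall j : nat, (j < n)%N -> al (lo + j%:Z) = be (lo + j%:Z).

Definition top_gt (n : nat) (al be : index) := exists k : nat,
  [/\ (k < n)%N, (be (lo + k%:Z)%R < al (lo + k%:Z)%R)%N &
      forall j : nat, (k < j < n)%N -> al (lo + j%:Z) = be (lo + j%:Z)].

(** Equal factors at the top are peeled off. At the first level where [al] exceeds [be], equality of
    the weights leaves [al] too little degree below that level for the lower operators of [be]. *)
Lemma dd_runs_psem_top n al be : wt al n = wt be n -> top_gt n al be ->
  dd_runs be n (psem al n) = 0.
Proof.
elim: n => [_ [k []] //|n IHn]; rewrite !wtS => wab [k [kn beal agr]].
rewrite -[LHS]/(dd_run _ _ (dd_runs be n (psem al n.+1))) dd_runs_psemS.
have [kn'|kn'] := eqVneq k n.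
  rewrite (@dd_runs_homog0 _ _ (wt al n)) ?mulr0 ?dd_run0 //; last exact: homog_psem.
  by rewrite kn' in beal; lia.
have aln : al (lo + n%:Z) = be (lo + n%:Z) by apply: agr; lia.
rewrite IHn ?mulr0 ?dd_run0 //; first by move: wab; rewrite aln => /addnI.
by exists k; split=> // [|j jk]; [lia|apply: agr; lia].
Qed.

(** A minimum for the lexicographic order that compares levels from the top down. *)
Lemma exists_top_min n (s : seq index) : s != [::] ->
  exists2 be, be \in s & forall al, al \in s -> agree_below n al be \/ top_gt n al be.
Proof.
elim: n s => [|n IHn] s s0.
  by case: s s0 => // be s _; exists be; rewrite ?mem_head // => al _; left.
pose v (al : index) := al (lo + n%:Z).
have [m /hasP[a0 a0s /eqP a0m] mmin] : exists2 m, has (fun al => v al == m) s &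
    forall k, has (fun al => v al == k) s -> (m <= k)%N.
  have ex : exists m, has (fun al => v al == m) s.
    by case: s s0 => // be s _; exists (v be); rewrite /= eqxx.
  by exists (ex_minn ex); case: ex_minnP.
have [|be] := IHn [seq al <- s | v al == m].
  by apply/eqP => /(congr1 (fun t => a0 \in t)); rewrite mem_filter a0m eqxx a0s.
rewrite mem_filter => /andP[/eqP bem bes] Hbe; exists be => // al als.
have [alm|alm] := eqVneq (v al) m.
  have [|agr|[k [kn bk kj]]] := Hbe al; first by rewrite mem_filter alm eqxx.
    left=> j; rewrite ltnS leq_eqVlt => /orP[/eqP ->|]; last exact: agr.
    by rewrite -[LHS]/(v al) alm -bem.
  right; exists k; split=> // [|j /andP[kj' jn]]; first exact: leqW.
  move: jn; rewrite ltnS leq_eqVlt => /orP[/eqP ->|jn]; last by apply: kj; rewrite kj'.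
  by rewrite -[LHS]/(v al) alm -bem.
right; exists n; split=> // [|j]; last lia.
rewrite -/(v be) -/(v al) bem ltn_neqAle eq_sym alm mmin //.
by apply/hasP; exists al.
Qed.

End Pairing.

Lemma dd_run_sum k a (T : Type) (s : seq T) (F : T -> fps) :
  dd_run k a (\sum_(t <- s) F t) = \sum_(t <- s) dd_run k a (F t).
Proof. by elim: a => [//|a IHa] /=; rewrite IHa dd_sum. Qed.

Lemma dd_runs_sum lo be n (T : Type) (s : seq T) (F : T -> fps) :
  dd_runs lo be n (\sum_(t <- s) F t) = \sum_(t <- s) dd_runs lo be n (F t).
Proof. by elim: n => [//|n IHn] /=; rewrite IHn dd_run_sum. Qed.

Lemma dd_runsZ lo be n c F : dd_runs lo be n (c *: F) = c *: dd_runs lo be n F.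
Proof.
have runZ k a G : dd_run k a (c *: G) = c *: dd_run k a G.
  by elim: a => [//|a IHa] /=; rewrite IHa ddZ.
by elim: n => [//|n IHn] /=; rewrite IHn runZ.
Qed.

Lemma sem_psem (lo : int) n (al : index) :
  (forall j : int, ~~ (lo <= j < lo + n%:Z) -> al j = 0%N) -> sem al = psem lo al n.
Proof.
move=> als; pose A := [fset (lo + j%:Z)%R | j in iota 0 n]%fset.
rewrite (@sem_fset A); last first.
  apply/fsubsetP => j; rewrite mem_finsupp => alj; apply/imfsetP.
  have jn : lo <= j < lo + n%:Z.
    by apply: contraT => /als al0; rewrite al0 in alj.
  by exists (absz (j - lo)) => /=; [rewrite mem_iota|]; lia.
rewrite /psem big_imfset /=; last by move=> i j _ _ /addrI [].
rewrite -(big_mkord xpredT (fun j => elemsym (lo + j%:Z) (al (lo + j%:Z)))).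
by rewrite /index_iota subn0 undup_id ?iota_uniq.
Qed.

Lemma sem_indep : lin_indep sem.
Proof.
move=> s c us sum0 a0 a0s; apply/eqP; apply: contraT => ca0.
have [N HN] : exists N : nat, forall al, al \in s -> forall j : int, (N <= absz j)%N -> al j = 0%N.
  elim: s {us sum0 a0s} => [|al s [N HN]]; first by exists 0%N.
  have [M HM] := fsfun_bound al; exists (maxn M N) => be; rewrite inE => /orP[/eqP ->|bs] j.
    by rewrite geq_max => /andP[/HM].
  by rewrite geq_max => /andP[_]; apply: HN.
pose lo : int := - N%:Z; pose n := (N + N)%N.
have semE al : al \in s -> sem al = psem lo al n.
  by move=> als; apply: sem_psem => j jN; apply: (HN _ als); lia.
(* The relation is paired with the minimal index [be] among the nonzero terms of the weight of [a0].
   The other terms of this weight die by [dd_runs_psem_top]. *)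
have [|be] := @exists_top_min lo n [seq al <- s | (c al != 0) && (wt lo al n == wt lo a0 n)].
  by apply/eqP => /(congr1 (fun t => a0 \in t)); rewrite mem_filter ca0 eqxx a0s.
rewrite mem_filter => /andP[/andP[cbe /eqP wbe] bes] Hbe.
have := congr1 (fun F => dd_runs lo be n F mone) sum0.
rewrite dd_runs_sum fps_sumE (bigD1_seq be) //= dd_runsZ semE // dd_runs_psem_diag.
rewrite fpsZE fps1E eqxx mulr1 big1_seq => [|al /andP[albe als]].
  rewrite addr0 => E; move: cbe; rewrite E.
  suff -> : dd_runs lo be n 0 mone = 0 by rewrite eqxx.
  by rewrite -(scale0r (0 : fps)) dd_runsZ scale0r.
rewrite dd_runsZ fpsZE semE //; have [->|cal] := eqVneq (c al) 0; first by rewrite mul0r.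
have [wal|wal] := eqVneq (wt lo al n) (wt lo be n).
  have [|agr|top] := Hbe al; first by rewrite mem_filter cal wal wbe eqxx als.
    case/eqP: albe; apply/fsfunP => j.
    have [jN|jN] := boolP (lo <= j < lo + n%:Z).
      have -> : j = lo + (absz (j - lo))%:Z by lia.
      by apply: agr; lia.
    by rewrite !(HN _ _ j) //; lia.
  by rewrite dd_runs_psem_top // mulr0.
(* Terms of another weight contribute nothing: those of smaller weight are killed, those of larger
   weight keep positive degree and have no constant term. *)
apply/eqP; rewrite mulf_eq0 (negPf cal) /=.
have [lt|gt|E] := ltngtP (wt lo al n) (wt lo be n); last by rewrite E eqxx in wal.
  by rewrite (dd_runs_homog0 lt (@homog_psem lo al n)).
apply: contraT => H; have := @dd_runs_homog lo be n (wt lo al n - wt lo be n) (psem lo al n).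
rewrite subnKC; last exact: ltnW.
by move=> /(_ (@homog_psem lo al n) _ H); rewrite mdeg1; lia.
Qed.

(** * The fundamental theorem of symmetric functions *)

Lemma aboveM (a : int) F G : above a (F * G) = above a F * above a G.
Proof.
apply/fpsP => m.
have [am|am] := pselect (forall i : int, m i != 0%N -> a <= i).
  rewrite aboveE // -[RHS]/(fps_mul _ _ m) -[LHS]/(fps_mul _ _ m).
  apply: fps_mul_local => u v uv.
  by split; rewrite aboveE // => i ui; apply: am; rewrite -uv cmM; lia.
rewrite above_out //; apply/esym/eqP; apply: contraT => /fps_mul_neq0[u [v [uv Fu Gv]]].
case: am => i; rewrite -uv cmM addn_eq0 negb_and => /orP[ui|vi].
  have [au|au] := pselect (forall i : int, u i != 0%N -> a <= i); first exact: au.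
  by rewrite above_out ?eqxx in Fu.
have [av|av] := pselect (forall i : int, v i != 0%N -> a <= i); first exact: av.
by rewrite above_out ?eqxx in Gv.
Qed.

Lemma aboveD (a : int) F G : above a (F + G) = above a F + above a G.
Proof. by apply/fpsP => m; rewrite fpsDE /above; case: asboolP => _; rewrite ?addr0. Qed.

Lemma above_0 a : above a 0 = 0.
Proof. by apply/fpsP => m; rewrite /above; case: asboolP. Qed.

Lemma above_1 a : above a 1 = 1.
Proof.
apply/fpsP => m; have [am|am] := pselect (forall i : int, m i != 0%N -> a <= i).
  by rewrite aboveE.
rewrite above_out // fps1E; case: eqP am => // -> [] i; by rewrite cm1.
Qed.

Lemma above_sum a (T : Type) (s : seq T) (P : pred T) (F : T -> fps) :
  above a (\sum_(i <- s | P i) F i) = \sum_(i <- s | P i) above a (F i).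
Proof.
by apply: (big_morph (above a)) => [F' G|]; [exact: aboveD|exact: above_0].
Qed.

Lemma above_prod a (T : Type) (s : seq T) (P : pred T) (F : T -> fps) :
  above a (\prod_(i <- s | P i) F i) = \prod_(i <- s | P i) above a (F i).
Proof.
by apply: (big_morph (above a)) => [F' G|]; [exact: aboveM|exact: above_1].
Qed.

Lemma aboveXn a F n : above a (F ^+ n) = above a F ^+ n.
Proof. by elim: n => [|n IHn]; rewrite ?above_1 // !exprS aboveM IHn. Qed.

Lemma aboveZ a c F : above a (c *: F) = c *: above a F.
Proof. by apply/fpsP => m; rewrite fpsZE /above; case: asboolP => _; rewrite ?mulr0. Qed.

(** Relates the adjacent swaps in [stable] to the finitary permutations in [Lambda_minus]: if w
    fixes all i > k, its descents are below k, so removing them uses only allowed swaps. *)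
Lemma sym_permZ (k : int) F : (forall i : int, i < k -> sw i F = F) ->
  forall w : permZ, (forall i : int, k < i -> w i = i) -> forall m, F (mrename w m) = F m.
Proof.
move=> sF; elim/permZ_ind => [_ m|w i di IH wk m].
  by congr F; apply: monomP => j; rewrite (@mrenameE _ id).
have ik : i < k by apply: desc_max di.
have wK : cancel w (w^-1)%g /\ cancel (w^-1)%g w by split; [exact: permZ_VK|exact: permZ_KV].
have wsK := conj (permZ_VK (w * sZ i)%g) (permZ_KV (w * sZ i)%g).
have E : mrename w m = mrename (w * sZ i)%g (msw i m).
  rewrite msw.unlock (@mrename_comp _ _ _ (sZ i) _ wsK.1 wsK.2 (sZK i) (sZK i)).
  by apply: mrename_ext => j; rewrite /= permZ_mulE sZK.
rewrite E IH; first by rewrite -swE sF.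
by move=> j kj; rewrite permZ_mulE sZ_id ?wk //; apply/eqP; lia.
Qed.

(* A symmetric series of degree at most [d] is determined by its terms in [d] variables:
   the gaps in the support of a monomial can be moved to the bottom. *)
Lemma sym_above_eq0 (k : int) (d : nat) F : stable k k d F ->
  above (k - d%:Z + 1) F = 0 -> F = 0.
Proof.
move=> [dF kF sF] tF; apply/fpsP => m; change (F m = 0).
have P r : forall m : monom, (forall i : int, m i != 0%N -> k - r%:Z + 1 <= i) -> F m = 0.
  elim: r => [|r IHr] {}m mr.
    rewrite -[RHS](_ : above (k - d%:Z + 1) F m = 0); last by rewrite tF.
    by rewrite aboveE // => i /mr; lia.
  apply/eqP; apply: contraT => Fm.
  have mk (i : int) : k < i -> m i = 0%N by apply: kF.
  have [rd|dr] := leqP r.+1 d.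
    case/eqP: Fm; rewrite -[RHS](_ : above (k - d%:Z + 1) F m = 0); last by rewrite tF.
    by rewrite aboveE // => i /mr; lia.
  have gap (n : nat) : forall m : monom, (forall i : int, m i != 0%N -> k - r.+1%:Z + 1 <= i) ->
      (n <= r)%N -> m (k - r%:Z + n%:Z) = 0%N -> F m = 0.
    elim: n => [|n IHn] {mr Fm mk}m mr nr mn.
      apply: IHr => i mi; have := mr _ mi.
      have : i != k - r%:Z by apply: contraNneq mi => ->; move: mn; rewrite addr0 => ->.
      lia.
    have ik : k - r%:Z + n%:Z < k by lia.
    rewrite -(sF _ ik) swE; apply: IHn; last 2 first.
    - exact: ltnW.
    - by rewrite mswE sZ_l; apply: etrans mn; congr (m _); lia.
    move=> i; rewrite mswE => /mr; rewrite sZE; case_ifs; lia.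
  have [[n [nr mn]]|nogap] := pselect (exists n : nat, (n <= r)%N /\ m (k - r%:Z + n%:Z) = 0%N).
    by case/eqP: Fm; apply: (gap n).
  (* Without a gap all r + 1 > d variables occur in m, so its degree exceeds d. *)
  have [I [Isz IE Iu]] : exists I : seq nat, [/\ size I = r.+1, I =i [pred j | j <= r]%N & uniq I].
    exists (iota 0 r.+1); split; rewrite ?size_iota ?iota_uniq // => j.
    by rewrite mem_iota inE.
  pose A := [fset (k - r%:Z + j%:Z)%R | j in I]%fset.
  have sA : (finsupp m `<=` A)%fset.
    apply/fsubsetP => i; rewrite -cmE_neq0 => mi; apply/imfsetP.
    have ki : i <= k by rewrite leNgt; apply/negP => /mk mi0; rewrite mi0 in mi.
    have mri := mr _ mi.
    have iI : absz (i - (k - r%:Z))%R \in I by rewrite IE inE; lia.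
    by exists (absz (i - (k - r%:Z))%R); [exact: iI|lia].
  have := dF _ Fm; rewrite (mdegEw sA) big_imfset /=; last by move=> i j _ _ /addrI [].
  rewrite undup_id // leqNgt => /negP[]; apply: leq_trans dr _.
  rewrite -Isz -sum1_size big_seq [leqRHS]big_seq.
  apply: leq_sum => j; rewrite IE inE => jr; rewrite lt0n.
  by apply/eqP => mj; apply: nogap; exists j.
have [l ml] := monom_bound m; apply: (P (absz (k + l%:Z)) m) => i /ml; lia.
Qed.

Lemma stable1 (a b : int) : stable a b 0 1.
Proof.
split=> [|m i|i _]; last exact: sw1; first exact/homog_deg/homog1.
by rewrite fps1E pnatr_eq0 eqb0 negbK => /eqP ->; rewrite cm1.
Qed.

Lemma stableXn (a b : int) d e F : stable a b d F -> stable a b (e * d) (F ^+ e).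
Proof.
move=> Fs; elim: e => [|e IHe]; first exact: stable1.
by rewrite exprS mulSn; apply: stableM.
Qed.

Lemma stable_prod (a b : int) (I : Type) (s : seq I) (d : I -> nat) (F : I -> fps) :
  (forall i, stable a b (d i) (F i)) -> stable a b (\sum_(i <- s) d i) (\prod_(i <- s) F i).
Proof.
move=> Fs; elim: s => [|i s IHs]; first by rewrite !big_nil; exact: stable1.
by rewrite !big_cons; apply: stableM.
Qed.

Lemma stable0 (a b : int) d : stable a b d 0.
Proof.
by split=> [m|m i|i _]; rewrite ?eqxx // sw.unlock.
Qed.

Lemma stable_sum (a b : int) d (I : eqType) (s : seq I) (F : I -> fps) :
  {in s, forall i, stable a b d (F i)} -> stable a b d (\sum_(i <- s) F i).
Proof.
move=> Fs; rewrite big_seq.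
by apply: big_ind => //; [exact: stable0|move=> *; exact: stableD].
Qed.

Lemma stable_elemsym (k : int) d : stable k k d (elemsym k d).
Proof.
split; [exact/homog_deg/homog_elemsym|exact: vars_le_elemsym|move=> i ik].
by apply: sw_elemsym; apply/eqP; lia.
Qed.

Lemma stableB (a b : int) d F G : stable a b d F -> stable a b d G -> stable a b d (F - G).
Proof. by move=> Fs Gs; rewrite -scaleN1r; apply: stableD => //; apply: stableZ. Qed.

(** * Transfer to symmetric polynomials in finitely many variables *)

Section SymmetricFunctions.

Import mpoly.

Variables (n : nat) (k : int).
Local Notation a := (k - n%:Z + 1).

(** Variable number i becomes x_(k - i), so the n variables are the topmost ones allowed, x_(k - n +
    1), ..., x_k. *)
Definition wmon (m : 'X_{1..n}) : monom :=
  \big[mmul/mone]_(i < n) expcmn (ucm (k - i%:Z)) (m i).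

Definition wmnm (m : monom) : 'X_{1..n} := [multinom m (k - (i : nat)%:Z)%R | i < n].

Lemma wmonE (m : 'X_{1..n}) (j : 'I_n) : wmon m (k - (j : nat)%:Z) = m j.
Proof.
rewrite cm_prodE (bigD1 j) //= expcmnE cmUU muln1 big1 ?addn0 // => i ij.
rewrite expcmnE cmU; case: eqP => [E|]; last by rewrite muln0.
by case/eqP: ij; apply: ord_inj; lia.
Qed.

Lemma wmon_out (m : 'X_{1..n}) (j : int) : ~~ (a <= j <= k) -> wmon m j = 0%N.
Proof.
move=> jn; rewrite cm_prodE big1 // => i _; rewrite expcmnE cmU; case: eqP => [E|].
  by move: jn; rewrite -E; have := ltn_ord i; lia.
by rewrite muln0.
Qed.

Lemma wmonK : cancel wmon wmnm.
Proof. by move=> m; apply/mnmP => i; rewrite mnmE wmonE. Qed.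

Lemma wmnmK (m : monom) : (forall i : int, m i != 0%N -> a <= i <= k) -> wmon (wmnm m) = m.
Proof.
move=> mw; apply: monomP => j; have [jn|jn] := boolP (a <= j <= k).
  have jlt : (absz (k - j)%R < n)%N by lia.
  have -> : j = k - (Ordinal jlt : nat)%:Z by move=> /=; lia.
  by rewrite wmonE mnmE.
by rewrite wmon_out //; apply/esym/eqP; apply: contraNT jn; exact: mw.
Qed.

Lemma mdeg_wmon (m : 'X_{1..n}) : monalg.mdeg (wmon m) = mpoly.mdeg m.
Proof.
rewrite mdeg_prod mpoly.mdegE; apply: eq_bigr => i _; exact: mdeg_expU.
Qed.

Definition wpoly : mpoly.mpoly n rat -> fps :=
  mmap (in_alg fps) (fun i : 'I_n => X (k - (i : nat)%:Z)).

Lemma wpolyX (m : 'X_{1..n}) : wpoly 'X_[m] = fps_of_poly << wmon m >>.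
Proof.
rewrite /wpoly mmapX /mmap1 /wmon.
have E (i : int) e : X i ^+ e = fps_of_poly << expcmn (ucm i) e >>.
  by rewrite X_polyE -(var_exp i e) (rmorphXn fps_of_poly).
under eq_bigr => i _ do rewrite E.
apply: esym; apply: (big_morph (fun m : monom => fps_of_poly << m >>)) => [u v|].
  by rewrite -[RHS](rmorphM fps_of_poly) /= (monalgUM u v).
exact: (rmorph1 fps_of_poly).
Qed.

Lemma wpolyE (p : mpoly.mpoly n rat) (m : monom) :
  wpoly p m = if `[< forall i : int, m i != 0%N -> a <= i <= k >] then p@_(wmnm m) else 0.
Proof.
rewrite {1}(mpolyE p) /wpoly raddf_sum fps_sumE /=.
under eq_bigr => u _ do rewrite mmapZ -/(wpoly _) wpolyX -scalerAl mul1r fpsZE fps_of_polyUE.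
case: asboolP => [mw|mw].
  have E u : (wmon u == m) = (u == wmnm m).
    by apply/eqP/eqP => [<-|->]; rewrite ?wmonK ?wmnmK.
  under eq_bigr => u _ do rewrite E.
  have [pm|pm] := boolP (wmnm m \in msupp p).
    rewrite (bigD1_seq (wmnm m)) ?msupp_uniq //= eqxx mulr1 big1 ?addr0 // => u /negPf ->.
    by rewrite mulr0.
  rewrite (memN_msupp_eq0 pm) big1_seq // => u /= up.
  by case: eqP up pm => [-> ->|]; rewrite ?mulr0.
rewrite big1 // => u _; case: eqP => [um|]; last by rewrite mulr0.
by case: mw => i; rewrite -um; apply: contraNT => /wmon_out ->.
Qed.


Lemma wpoly_mesym (i : 'I_n) : wpoly (mesym n rat i.+1) = above a (elemsym k i.+1).
Proof.
apply/fpsP => m; rewrite wpolyE; case: asboolP => [mw|nmw].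
  rewrite aboveE => [|j /mw/andP[]//].
  rewrite mcoeff_mesym /elemsym; congr (_%:R); congr nat_of_bool; rewrite /mechar.
  rewrite -mdeg_wmon wmnmK //; congr (_ && _); apply/forallP/allP => [H j|H j].
    rewrite -cmE_neq0 => mj; have /andP[ja jk] := mw _ mj; rewrite jk /=.
    have jlt : (absz (k - j)%R < n)%N by lia.
    have := H (Ordinal jlt); rewrite mnmE.
    have -> : k - (Ordinal jlt : nat)%:Z = j by move=> /=; lia.
    by rewrite eqn_leq lt0n mj andbT.
  rewrite mnmE; have [->//|mj] := eqVneq (m (k - (j : nat)%:Z)) 0%N.
  by rewrite cmE_neq0 in mj; have /andP[_ /eqP ->] := H _ mj.
have [am|am] := pselect (forall j : int, m j != 0%N -> a <= j); last by rewrite above_out.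
rewrite aboveE //; apply/esym/eqP; apply: contraT => /elemsymP[_ H].
by case: nmw => j mj; rewrite am //=; have /andP[] := H _ mj.
Qed.

(** The test j <= k is there because [absz] forgets the sign of k - j. *)
Definition sig_fun (s : 'S_n) (j : int) : int :=
  if insub (absz (k - j)%R) is Some i then if j <= k then k - (s i : nat)%:Z else j else j.

Lemma sig_in (s : 'S_n) (i : 'I_n) : sig_fun s (k - (i : nat)%:Z) = k - (s i : nat)%:Z.
Proof.
rewrite /sig_fun; have -> : absz (k - (k - (i : nat)%:Z))%R = i by lia.
by rewrite valK ifT //; lia.
Qed.

Lemma sig_out (s : 'S_n) (j : int) : ~~ (a <= j <= k) -> sig_fun s j = j.
Proof.
move=> jn; rewrite /sig_fun; case: insubP => // i ilt iE; rewrite ifF //.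
by have := ltn_ord i; lia.
Qed.

Lemma sigK (s : 'S_n) : cancel (sig_fun s) (sig_fun s^-1%g).
Proof.
move=> j; have [jn|jn] := boolP (a <= j <= k); last by rewrite !sig_out.
have jlt : (absz (k - j)%R < n)%N by lia.
have -> : j = k - (Ordinal jlt : nat)%:Z by move=> /=; lia.
by rewrite !sig_in permK.
Qed.

Lemma sigKV (s : 'S_n) : cancel (sig_fun s^-1%g) (sig_fun s).
Proof. by move=> j; rewrite -{1}(invgK s) sigK. Qed.

Lemma sig_finite (s : 'S_n) : finite_set [set j | sig_fun s j <> j].
Proof.
apply: (sub_finite_set _ (finite_image (fun i : nat => k - i%:Z) (finite_II n))) => j /= sj.
have [jn|jn] := boolP (a <= j <= k); last by case: sj; rewrite sig_out.
by exists (absz (k - j)%R) => /=; lia.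
Qed.

Definition sig (s : 'S_n) : permZ := PermZ (Bijective (@sigK s) (@sigKV s)) (sig_finite s).

Lemma wmon_perm (m : 'X_{1..n}) (s : 'S_n) :
  wmon [multinom m (s i) | i < n] = mrename (sig s^-1%g) (wmon m).
Proof.
apply: monomP => j; rewrite (@mrenameE _ (sig_fun s)); [|exact: sigKV|exact: sigK].
have [jn|jn] := boolP (a <= j <= k); last by rewrite sig_out // !wmon_out.
have jlt : (absz (k - j)%R < n)%N by lia.
have -> : j = k - (Ordinal jlt : nat)%:Z by move=> /=; lia.
by rewrite sig_in !wmonE mnmE.
Qed.

(** The number n of variables is also the degree bound, so by [sym_above_eq0] truncation loses
    nothing. The truncation of F is a polynomial in elementary polynomials, and G is the same
    polynomial in the full elementary symmetric functions. *)
Lemma sym_semspan_aux F : stable k k n F -> semspan F.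
Proof.
move=> Fs; have [dF kF sF] := Fs.
pose p : mpoly.mpoly n rat := \sum_(m : 'X_{1..n < n.+1}) (F (wmon m) *: 'X_[m]).
have pE m : p@_m = F (wmon m).
  have [mn|mn] := ltnP (mpoly.mdeg m) n.+1.
    exact: (mcoeff_mpoly (fun m => F (wmon m)) mn).
  rewrite raddf_sum /= big1 => [|u _].
    apply/esym/eqP; apply: contraT => /dF; rewrite mdeg_wmon; lia.
  rewrite mcoeffZ mcoeffX; case: eqP => [um|]; last by rewrite mulr0.
  by have := bmdeg u; rewrite um; lia.
have pwE : wpoly p = above a F.
  apply/fpsP => m; rewrite wpolyE pE; case: asboolP => [mw|nmw].
    by rewrite wmnmK // aboveE // => j /mw /andP[].
  have [am|am] := pselect (forall j : int, m j != 0%N -> a <= j); last by rewrite above_out.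
  rewrite aboveE //; apply/esym/eqP; apply: contraT => Fm; case: nmw => j mj.
  by rewrite am //= leNgt; apply/negP => /(kF _ _ Fm) mj0; rewrite mj0 in mj.
have psize : (msize p <= n.+1)%N.
  rewrite msizeE; apply/bigmax_leqP_seq => m; rewrite mcoeff_msupp pE => /dF.
  by rewrite mdeg_wmon.
have psym : p \is symmetric.
  apply/issymP => s; apply/mpolyP => m; rewrite mcoeff_sym !pE wmon_perm.
  apply: (sym_permZ sF) => j jk; apply: sig_out; lia.
have [t [tp tw]] := sym_fundamental psym.
pose G := \sum_(m <- msupp t) t@_m *: \prod_(i < n) (elemsym k i.+1) ^+ (m i).
have GE : semspan G.
  apply: semspan_sum => m _; apply: semspanZ; rewrite -[\prod_(_ < _) _]mulr1.
  pose Q x := forall H, semspan H -> semspan (x * H).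
  suff : Q (\prod_(i < n) (elemsym k i.+1) ^+ (m i)) by apply; exact: semspan1.
  apply: (big_ind Q) => [H|x y Qx Qy H HE|i _]; first by rewrite mul1r.
    by rewrite -mulrA; apply: Qx; apply: Qy.
  elim: (m i) => [|e IHe] H HE; first by rewrite mul1r.
  by rewrite exprS -mulrA; apply: semspan_elemsym; apply: IHe.
(* The weight bound of the fundamental theorem keeps the degree of G within n; otherwise the
   equality of the truncations would not give F = G. *)
have Gs : stable k k n G.
  apply: stable_sum => m mt; apply: stableZ.
  have : (\sum_(i < n) m i * i.+1 <= n)%N.
    by have := leq_trans (leq_trans (mmeasure_mnm_lt _ mt) tw) psize.
  move=> wn; apply: (stableS (lexx k) (lexx k) wn); apply: stable_prod => i.
  exact/stableXn/stable_elemsym.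
have aG : above a G = above a F.
  rewrite -pwE -tp comp_mpolyE /wpoly raddf_sum above_sum /=.
  apply: eq_bigr => m _; rewrite mmapZ -/(wpoly _) aboveZ -scalerAl mul1r; congr (_ *: _).
  rewrite /wpoly rmorph_prod above_prod /=; apply: eq_bigr => i _.
  by rewrite rmorphXn /= aboveXn tnth_mktuple -/(wpoly _) wpoly_mesym.
suff -> : F = G by [].
apply/eqP; rewrite -subr_eq0; apply/eqP; apply: sym_above_eq0 (stableB Fs Gs) _.
by rewrite aboveB aG subrr.
Qed.

End SymmetricFunctions.

Lemma sym_semspan (k : int) d F : stable k k d F -> semspan F.
Proof. exact: sym_semspan_aux. Qed.

(** * Removing the variables outside the symmetric range *)

(** Division by x_b with remainder. The symmetry survives because the swaps s_i with i < a < b do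
    not move x_b. The last clause covers d = 0, where [d.-1] is no smaller than d. *)
Lemma stable_split (a b : int) d F : a < b -> stable a b d F -> exists F0 F1,
  [/\ F = F0 + X b * F1, stable a (b - 1) d F0, stable a b d.-1 F1 & d = 0%N -> F1 = 0].
Proof.
move=> ab [dF bF sF].
pose F0 : fps := fun m => if m b == 0%N then F m else 0.
pose F1 : fps := fun m => F (mmul (ucm b) m).
have F0E m : F0 m != 0 -> m b = 0%N /\ F m != 0.
  by rewrite /F0; case: (eqVneq (m b) 0%N) => [->|_]; rewrite ?eqxx.
have dF1 m : F1 m != 0 -> (mdeg m < d)%N.
  by move=> /dF; rewrite mdegM mdegU.
exists F0, F1; split.
- apply/fpsP => m; rewrite fpsDE X_mulE /F0 /F1.
  by case: eqP => [_|/eqP mb]; rewrite ?addr0 ?add0r // mdivK.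
- split=> [m /F0E[_ /dF]//|m i /F0E[mb Fm] bi|i ia].
    by have [->//|ib] := eqVneq i b; apply: bF Fm _; lia.
  apply/fpsP => m; rewrite swE /F0 mswE sZ_id; try by apply/eqP; lia.
  by case: eqP => // _; rewrite -swE sF.
- split=> [m /dF1|m i F1m bi|i ia]; first by case: (d) => // e; rewrite ltnS.
    by have := bF _ i F1m bi; rewrite cmM => /eqP; rewrite addn_eq0 => /andP[_ /eqP].
  apply/fpsP => m; rewrite swE /F1 -[in RHS](sF i ia) swE; apply: (congr1 F).
  apply: monomP => j; rewrite mswE !cmM !mswE !cmU; congr (nat_of_bool _ + _)%N.
  have sb : sZ i b = b by apply: sZ_id; apply/eqP; lia.
  by rewrite -[in RHS]sb (inj_eq (inv_inj (sZK i))).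
move=> d0; apply/fpsP => m; apply/eqP; apply: contraT => /dF1; rewrite d0 //.
Qed.

(** The remainder loses the variable x_b and the quotient loses a degree, so an outer induction on b
    - a and an inner one on d end at b <= a, where F is symmetric in all its variables. *)
Lemma back_stable_semspan F : back_stable F -> semspan F.
Proof.
move=> [a [b [d]]]; have [n le_n] := ubnP (absz (Order.max 0 (b - a))).
elim: n a b d F le_n => [//|n IHn] a b d F le_n.
have [ba|ab] := leP b a.
  by move=> Fs; apply: (@sym_semspan b d); apply: stableS Fs.
elim: d F => [|d IHd] F /(stable_split ab)[F0 [F1 [-> F0s F1s F1z]]]; apply: semspanD.
- by apply: IHn F0s; lia.
- by rewrite F1z // mulr0; exact: semspan0.
- by apply: IHn F0s; lia.
exact/semspanX/IHd.
Qed.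

Lemma back_stable_elemsym (k : int) d : back_stable (elemsym k d).
Proof. by exists k, k, d; exact: stable_elemsym. Qed.

Lemma back_stableX i : back_stable (X i).
Proof.
rewrite X_elemsym -scaleN1r; apply: back_stableD; first exact: back_stable_elemsym.
exact/back_stableZ/back_stable_elemsym.
Qed.

Lemma back_stable_poly p : back_stable (fps_of_poly p).
Proof.
apply: (@fps_poly_ind back_stable);
  [exact: back_stable0|exact: back_stableD|exact: back_stableZ| |].
  by exists 0, 0, 0%N; exact: stable1.
by move=> i F; apply: back_stableM; exact: back_stableX.
Qed.

(** * The ring R *)

Lemma Lambda_stable f : Lambda_minus f -> exists d, stable 0 0 d f.
Proof.
move=> [[d df] vf sf]; exists d; split=> // [m i fm i0|i i0].
  apply/eqP; apply: contraT; rewrite cmE_neq0 => /(vf _ fm); lia.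
apply/fpsP => m; rewrite sw.unlock; apply: sf => j j0; apply: sZ_id; apply/eqP; lia.
Qed.

Lemma stable_Lambda d f : stable 0 0 d f -> Lambda_minus f.
Proof.
move=> [df vf sf]; split; first by exists d.
  move=> m fm i; rewrite -cmE_neq0 => mi; rewrite leNgt; apply/negP => /(vf _ _ fm) mi0.
  by rewrite mi0 in mi.
by move=> w w0 m; apply: (sym_permZ sf).
Qed.

Lemma ringR_back_stable F : ringR F -> back_stable F.
Proof.
move=> [n [f [p [fL ->]]]]; apply: back_stable_sum => j _; apply: back_stableM.
  by have [d fs] := Lambda_stable (fL j); exists 0, 0, d.
exact: back_stable_poly.
Qed.

Lemma ringRD F G : ringR F -> ringR G -> ringR (F + G).
Proof.
move=> [n [f [p [fL ->]]]] [n' [f' [p' [fL' ->]]]].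
exists (n + n')%N, (fun j => match fintype.split j with inl i => f i | inr i => f' i end),
  (fun j => match fintype.split j with inl i => p i | inr i => p' i end); split.
  by move=> j; case: (fintype.split j).
rewrite big_split_ord /=; congr (_ + _); apply: eq_bigr => j _.
  by rewrite (unsplitK (inl _ j)).
by rewrite (unsplitK (inr _ j)).
Qed.

Lemma ringR_polyM q F : ringR F -> ringR (fps_of_poly q * F).
Proof.
move=> [n [f [p [fL ->]]]]; exists n, f, (fun j => q * p j); split=> //.
rewrite mulr_sumr; apply: eq_bigr => j _.
by rewrite (rmorphM fps_of_poly) mulrCA.
Qed.

Lemma ringR_LambdaM f F : Lambda_minus f -> ringR F -> ringR (f * F).
Proof.
move=> /Lambda_stable[d fs] [n [g [p [gL ->]]]]; exists n, (fun j => f * g j), p; split.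
  move=> j; have [e gs] := Lambda_stable (gL j).
  exact: stable_Lambda (stableM fs gs).
by rewrite mulr_sumr; apply: eq_bigr => j _; rewrite mulrA.
Qed.

Lemma ringRZ c F : ringR F -> ringR (c *: F).
Proof.
move=> /(ringR_polyM (c *: 1)); rewrite fps_of_polyZ (rmorph1 fps_of_poly).
by rewrite -scalerAl mul1r.
Qed.

Lemma ringR_XM i F : ringR F -> ringR (X i * F).
Proof. by rewrite X_polyE; exact: ringR_polyM. Qed.

Lemma ringR1 : ringR 1.
Proof.
exists 1%N, (fun=> 1), (fun=> 1); split; first by move=> j; apply: stable_Lambda (stable1 0 0).
by rewrite big_ord1 (rmorph1 fps_of_poly) mulr1.
Qed.

(** The series e(0) lies in Lambda^-. For k > 0 the recursion [elemsymS] climbs from there; for k <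
    0 it is solved for the lower level, with an additional induction on d. *)
Lemma ringR_elemsymM (k : int) d F : ringR F -> ringR (elemsym k d * F).
Proof.
have H0 e G : ringR G -> ringR (elemsym 0 e * G).
  by apply: ringR_LambdaM; apply: stable_Lambda (stable_elemsym 0 e).
have [k0|k0] := leP 0 k.
  have -> : k = (absz k)%:Z by lia.
  elim: (absz k) d F => [|n IHn] d F; first exact: H0.
  case: d => [|d] FR; first by rewrite elemsym0 mul1r.
  have nE : n.+1%:Z - 1 = n%:Z by lia.
  rewrite elemsymS nE mulrDl -mulrA; apply: ringRD; first exact: IHn.
  by apply: ringR_XM; apply: IHn.
have -> : k = - (absz k)%:Z by lia.
elim: (absz k) d F => [|n IHn] d F; first by rewrite oppr0; exact: H0.
elim: d F => [|d IHd] F FR; first by rewrite elemsym0 mul1r.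
have nE : - n%:Z - 1 = - n.+1%:Z by lia.
have -> : elemsym (- n.+1%:Z) d.+1 = elemsym (- n%:Z) d.+1 - X (- n%:Z) * elemsym (- n.+1%:Z) d.
  by rewrite [elemsym (- n%:Z) _]elemsymS nE; ring.
rewrite mulrBl -scaleN1r -mulrA; apply: ringRD; first exact: IHn.
by apply: ringRZ; apply: ringR_XM; apply: IHd.
Qed.

Lemma semspan_ringR F : semspan F -> ringR F.
Proof.
have ringR0 : ringR 0 by have := ringRZ 0 ringR1; rewrite scale0r.
move=> [s [c ->]]; apply: big_ind => // [|al _]; first exact: ringRD.
apply: ringRZ; rewrite /back_stable_sem; apply: big_rec => [|i G _ GR]; first exact: ringR1.
exact: ringR_elemsymM.
Qed.

Theorem theorem1p1 :
  is_basis back_stable_sem ringR /\ is_basis back_stable_schubert ringR.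
Proof.
(* The inclusions of R in the back stable series, of these in the span, and of the span in R form a
   cycle. *)
have RE : ringR = back_stable.
  rewrite predeqE => F; split; first exact: ringR_back_stable.
  by move=> /back_stable_semspan /semspan_ringR.
have SE : semspan = ringR.
  rewrite predeqE => F; split; first exact: semspan_ringR.
  by move=> /ringR_back_stable /back_stable_semspan.
split; first by split; [exact: sem_indep|exact: SE].
by rewrite RE; have := bss_basis; rewrite bss.unlock.
Qed.
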